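(* There exists an absolute constant $c>0$ such that for every integer $n\ge 2$ there is a constant $C_n>0$, depending only on $n$, with the following property. Let $p$ be a prime and let $S\subseteq \mathbb{F}_p^n$ be a subset such that for every direction there is a line $l$ in this direction with $|l\cap S|\ge p^{1/2}$. Then $$|S|\ \ge\ C_n\, p^{\frac n2+\frac{c}{n^2}}.$$
   Context: $\mathbb{F}_p$ is the field with $p$ elements. A line in $\mathbb{F}_p^n$ is a set $\{a+tv : t\in\mathbb{F}_p\}$ with $a,v\in\mathbb{F}_p^n$, $v\neq 0$; its direction is the class of $v$ up to nonzero scalar multiples. ''For every direction'' means for every nonzero $v\in\mathbb{F}_p^n$ up to scalar multiples. *)

(* Defs.v *)
From HB Require Import structures.
From mathcomp Require Import all_boot all_order all_algebra.
From mathcomp Require Import reals exp.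

Set Implicit Arguments.
Unset Strict Implicit.
Unset Printing Implicit Defensive.

Import GRing.Theory.
Local Open Scope ring_scope.

Section Lines.
Variables (F : finFieldType) (n : nat).
Implicit Types (a v : 'rV[F]_n) (l : {set 'rV[F]_n}).

(* This set is a line only when [v != 0]. *)
Definition line a v : {set 'rV[F]_n} := [set a + t *: v | t : F].

(* A direction is represented by any nonzero [v] in its class: replacing [v] by
   a nonzero scalar multiple does not change [line a v]. *)
Definition line_in_direction v l : Prop := v != 0 /\ exists a, l = line a v.

End Lines.

(* Main.v *)
Require Import Defs.
From HB Require Import structures.
From mathcomp Require Import all_boot all_order all_algebra.
From mathcomp Require Import zify ring.
From mathcomp Require Import reals exp.

Set Implicit Arguments.
Unset Strict Implicit.
Unset Printing Implicit Defensive.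

Import Order.TTheory GRing.Theory Num.Theory.

(** Let [N] be the size of [S].  The trivial bound, of order [p^(n/2)],
    comes from counting pairs of points on a common line, and the proof is a
    stability analysis of that count: if [N^2 <= K p^n], then [p <= K^E] for an absolute
    exponent [E] (lemma [furstenberg_bound]).  Rounding [N^2 / p^n] up to get [K],
    this gives [N >= C p^(n/2 + 1/(2E))], which is more than what is asked since
    [c / n^2 <= c].  Below, a loss is a factor bounded by a fixed power of [K].

    One line is kept for each direction [(1, u)], with about [p^(1/2)] marked
    points in [S].  By Cauchy-Schwarz some line [l0] is crossed at its marked
    points by [N] other lines, up to a loss; so a positive proportion, up to a
    loss, of the pairs formed by a point of [S] and a marked point of [l0] are
    joined by a line of the family ([exists_crossed_line], [card_rich_points]).
    A point [x] joined to many points of [l0] forces about [p] points of [S] in the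
    plane spanned by [x] and [l0] ([bush]), so there are few such planes and one of
    them contains about [p] of these rich points ([exists_rich_class]).  At most
    [p] lines of the family cross [l0] within that plane, because their directions
    are distinct.  This is where the dimension disappears: what remains is a planar
    configuration of [p] points and [p] lines that is extremal for Cauchy-Schwarz,
    and which a prime field does not allow.

    A projective map sends [l0] to infinity, and its points become pencils of
    parallel lines, with about [p^(1/2)] lines each.  Two of the pencils give
    coordinates in sets [A] and [B] of size [p^(1/2)], and each of the others says
    that [a - s b] takes few values on a dense subset of [A x B], for about
    [p^(1/2)] slopes [s] ([plane_bound]).  The Balog-Szemeredi-Gowers theorem and a
    pigeonhole argument produce one set [A0] with [|A0 - s A0|] comparable to
    [|A0|] for that many ratios [s] ([balog_szemeredi_gowers],
    [common_structure]).  Such ratios are stable under the field operations, by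
    the inequalities of Ruzsa and Pluennecke; a fixed rational expression in them
    then yields about [p] good ratios ([sum_product_growth]).  But an energy count
    allows only [p^(1/2)] of them, up to a loss ([card_small_dilates]).

    All the estimates are between natural numbers, with [K >= 2], so that numerical
    constants are absorbed into powers of [K]. *)

(** * Double counting *)

Lemma card_set_sum (I : finType) (A : {set I}) (P : pred I) :
  #|[set i in A | P i]| = \sum_(i in A) P i.
Proof.
rewrite -sum1dep_card big_mkcondr; apply: eq_bigr => i _; by case: (P i).
Qed.

Lemma card_pair_sum (I J : finType) (A : {set I}) (B : I -> {set J}) :
  #|[set x : I * J | (x.1 \in A) && (x.2 \in B x.1)]| = \sum_(i in A) #|B i|.
Proof.
rewrite -sum1dep_card -(pair_big_dep (mem A) (fun i j => j \in B i) (fun _ _ => 1)) /=.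
by apply: eq_bigr => i _; rewrite sum1_card.
Qed.

Lemma cauchy_schwarz (I : finType) (A : {set I}) (f : I -> nat) :
  (\sum_(i in A) f i) ^ 2 <= #|A| * \sum_(i in A) f i ^ 2.
Proof.
rewrite -(@leq_pmul2l 2) //.
have -> : 2 * (\sum_(i in A) f i) ^ 2 = \sum_(i in A) \sum_(j in A) 2 * (f i * f j).
  rewrite expnS expn1 big_distrlr /= big_distrr /=.
  by apply: eq_bigr => i _; rewrite big_distrr.
have -> : 2 * (#|A| * \sum_(i in A) f i ^ 2) =
   \sum_(i in A) \sum_(j in A) (f i ^ 2 + f j ^ 2).
  under [RHS]eq_bigr do rewrite big_split /= sum_nat_const.
  rewrite big_split /= -big_distrr /= sum_nat_const; lia.
apply: leq_sum => i _; apply: leq_sum => j _.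
by rewrite nat_Cauchy.
Qed.

(** Popularity principle: if the average of a function bounded by [M] is at least
    [M / K], then it is at least half of that on a proportion [1 / (2 K)] of the
    indices.  The number [a] only has to bound the number of indices. *)
Lemma popular (I : finType) (A : {set I}) (f : I -> nat) (a M K : nat) :
  0 < M -> #|A| <= a -> (forall i, i \in A -> f i <= M) ->
  a * M <= K * \sum_(i in A) f i ->
  a <= 2 * K * #|[set i in A | M <= 2 * K * f i]|.
Proof.
move=> M0 Aa fM h.
rewrite -(leq_pmul2r M0).
have : 2 * K * \sum_(i in A) f i <=
       2 * K * (#|[set i in A | M <= 2 * K * f i]| * M) + #|A| * M.
  rewrite card_set_sum big_distrl /= !big_distrr /= -sum_nat_const -big_split /=.
  apply: leq_sum => i iA; case: (leqP M (2 * K * f i)) => h1 /=; last lia.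
  by have := leq_mul (leqnn (2 * K)) (fM i iA); lia.
have := leq_mul Aa (leqnn M); lia.
Qed.

Lemma exists_average (I : finType) (A : {set I}) (f g : I -> nat) (i0 : I) :
  i0 \in A -> \sum_(i in A) f i <= \sum_(i in A) g i -> exists2 i, i \in A & f i <= g i.
Proof.
move=> i0A h; apply/exists_inP; apply: contraLR h => /exists_inPn h.
rewrite -ltnNge; apply: (@leq_trans (\sum_(i in A) (g i).+1)).
  by rewrite (bigD1 i0) //= [X in _ < X](bigD1 i0) //= addSn ltnS leq_add2l; apply: leq_sum.
by apply: leq_sum => i /h; rewrite -ltnNge.
Qed.

(** A map with a small image has many pairs with equal values. *)
Lemma collisions (I J : finType) (A : {set I}) (f : I -> J) :
  #|A| ^ 2 <= #|f @: A| * #|[set x : I * I | [&& x.1 \in A, x.2 \in A & f x.1 == f x.2]]|.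
Proof.
have -> : #|A| = \sum_(j in f @: A) #|[set i in A | f i == j]|.
  rewrite -sum1_card (partition_big_imset f) /=; apply: eq_bigr => j _.
  by rewrite -sum1dep_card; apply: eq_bigl => i.
apply: leq_trans (cauchy_schwarz _ _) _; rewrite leq_mul2l; apply/orP; right.
have -> : [set x : I * I | [&& x.1 \in A, x.2 \in A & f x.1 == f x.2]] =
          [set x : I * I | (x.1 \in A) && (x.2 \in [set i in A | f i == f x.1])].
  by apply/setP => x; rewrite !inE eq_sym.
rewrite (card_pair_sum A (fun x => [set i in A | f i == f x])).
rewrite (partition_big_imset f) /=; apply: leq_sum => j _.
rewrite (eq_bigr (fun=> #|[set i in A | f i == j]|)); last by move=> i /andP[_ /eqP ->].
rewrite expnS expn1 -[X in X * _ <= _]sum1dep_card big_distrl /=.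
by under eq_bigr do rewrite mul1n.
Qed.

(** * Sumsets, and the inequalities of Ruzsa and Petridis *)

(** A set of representatives for the fibres of [f] over [A]. *)
Lemma imset_section (I J : finType) (f : I -> J) (A : {set I}) :
  exists A0 : {set I},
    [/\ A0 \subset A, {in A0 &, injective f} & #|A0| = #|f @: A|].
Proof.
pose g i := [pick i' in A | f i' == f i].
have gE i j : f i = f j -> g i = g j by move=> e; apply: eq_pick => k; rewrite e.
have finj : {in [set i in A | g i == Some i] &, injective f}.
  move=> i j; rewrite !inE => /andP[_ /eqP gi] /andP[_ /eqP gj] /gE.
  by rewrite gi gj => -[].
exists [set i in A | g i == Some i]; split => //.
  by apply/subsetP => i; rewrite inE => /andP[].
rewrite -(card_in_imset finj); congr #|pred_of_set _|; apply/eqP.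
rewrite eqEsubset imsetS /=; last by apply/subsetP => i; rewrite inE => /andP[].
apply/subsetP => _ /imsetP[i iA ->].
have := erefl (g i); rewrite {2}/g; case: pickP => [k /andP[kA /eqP fk] gi|/(_ i)].
  by rewrite -fk imset_f // inE kA (gE _ _ fk) gi eqxx.
  by rewrite iA eqxx.
Qed.

Section Sumsets.
Variable V : finZmodType.
Implicit Types A B C X Y Z : {set V}.
Local Open Scope ring_scope.

(** The sumset A + B. *)
Definition sumset A B : {set V} := [set x.1 + x.2 | x in setX A B].
(** The difference set A - B; this is not the set-theoretic difference. *)
Definition diffset A B : {set V} := [set x.1 - x.2 | x in setX A B].
(** The reflected set - A. *)
Definition oppset A : {set V} := [set - x | x in A].

Lemma sumsetP A B z :
  reflect (exists x y, [/\ x \in A, y \in B & z = x + y]) (z \in sumset A B).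
Proof.
apply: (iffP imsetP) => [[[x y]] /[!inE] /andP[xA yB] ->|[x [y [xA yB ->]]]].
  by exists x, y.
by exists (x, y); rewrite ?inE /= ?xA.
Qed.

Lemma diffsetP A B z :
  reflect (exists x y, [/\ x \in A, y \in B & z = x - y]) (z \in diffset A B).
Proof.
apply: (iffP imsetP) => [[[x y]] /[!inE] /andP[xA yB] ->|[x [y [xA yB ->]]]].
  by exists x, y.
by exists (x, y); rewrite ?inE /= ?xA.
Qed.

Lemma mem_sumset A B x y : x \in A -> y \in B -> x + y \in sumset A B.
Proof. by move=> xA yB; apply/sumsetP; exists x, y. Qed.

Lemma mem_diffset A B x y : x \in A -> y \in B -> x - y \in diffset A B.
Proof. by move=> xA yB; apply/diffsetP; exists x, y. Qed.

Lemma sumsetA A B C : sumset A (sumset B C) = sumset (sumset A B) C.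
Proof.
apply/setP => z; apply/sumsetP/sumsetP.
  move=> [x [_ [xA /sumsetP[y [w [yB wC ->]]] ->]]].
  by exists (x + y), w; rewrite mem_sumset // addrA.
move=> [_ [w [/sumsetP[x [y [xA yB ->]]] wC ->]]].
by exists x, (y + w); rewrite mem_sumset // addrA.
Qed.

Lemma sumsetC A B : sumset A B = sumset B A.
Proof.
by apply/setP => z; apply/sumsetP/sumsetP => -[x [y [xA yB ->]]]; exists y, x;
  rewrite addrC.
Qed.

Lemma diffsetS A A' B B' :
  A \subset A' -> B \subset B' -> diffset A B \subset diffset A' B'.
Proof.
move=> /subsetP AA /subsetP BB; apply/subsetP => z /diffsetP[x [y [xA yB ->]]].
by rewrite mem_diffset ?AA ?BB.
Qed.

Lemma card_oppset A : #|oppset A| = #|A|.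
Proof. by apply: card_imset; exact: oppr_inj. Qed.

Lemma oppset_diff A B : oppset (diffset A B) = diffset B A.
Proof.
apply/setP => z; apply/imsetP/diffsetP => [[_ /diffsetP[x [y [xA yB ->]]] ->]|].
  by exists y, x; rewrite opprB.
by move=> [y [x [yB xA ->]]]; exists (x - y); rewrite ?mem_diffset ?opprB.
Qed.

Lemma card_diffsetC A B : #|diffset A B| = #|diffset B A|.
Proof. by rewrite -oppset_diff card_oppset. Qed.

Lemma diffset_oppr A B : diffset A (oppset B) = sumset A B.
Proof.
apply/setP => z; apply/diffsetP/sumsetP => [[x [_ [xA /imsetP[y yB ->] ->]]]|].
  by exists x, y; rewrite opprK.
by move=> [x [y [xA yB ->]]]; exists x, (- y); rewrite opprK imset_f.
Qed.

Lemma sumset_oppr A B : sumset A (oppset B) = diffset A B.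
Proof.
apply/setP => z; apply/sumsetP/diffsetP => [[x [_ [xA /imsetP[y yB ->] ->]]]|].
  by exists x, y.
by move=> [x [y [xA yB ->]]]; exists x, (- y); rewrite imset_f.
Qed.

Lemma oppset_sum A B : oppset (sumset A B) = sumset (oppset A) (oppset B).
Proof.
apply/setP => z; apply/imsetP/sumsetP => [[_ /sumsetP[x [y [xA yB ->]]] ->]|].
  by exists (- x), (- y); rewrite !imset_f // opprD.
move=> [_ [_ [/imsetP[x xA ->] /imsetP[y yB ->] ->]]].
by exists (x + y); rewrite ?mem_sumset // opprD.
Qed.

Lemma leq_card_sumsetl A B : B != set0 -> (#|A| <= #|sumset A B|)%N.
Proof.
move=> /set0Pn[b bB]; rewrite -(card_imset A (addIr b)).
by apply/subset_leq_card/subsetP => _ /imsetP[a aA ->]; rewrite mem_sumset.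
Qed.

(** If [x - z] is a fixed representation of an element [d] of [X - Z], the pair
    [(x - y, y - z)] determines [d] by summation, hence [x], [z] and [y]. *)
Lemma ruzsa_triangle X Y Z :
  (#|diffset X Z| * #|Y| <= #|diffset X Y| * #|diffset Y Z|)%N.
Proof.
have [D [DXZ Dinj <-]] := imset_section (fun x : V * V => x.1 - x.2) (setX X Z).
rewrite -!cardsX.
pose h (q : (V * V) * V) := (q.1.1 - q.2, q.2 - q.1.2).
have hinj : {in setX D Y &, injective h}.
  move=> [[x z] y] [[x' z'] y']; rewrite !inE /= => /andP[d yY] /andP[d' y'Y].
  rewrite /h /= => -[e1 e2].
  have e : (x, z) = (x', z').
    by apply: Dinj => //=; rewrite -(subrKA y) e1 e2 subrKA.
  by case: e => ex ez; move: e1; rewrite ex ez => /addrI/oppr_inj ->.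
rewrite -(card_in_imset hinj); apply/subset_leq_card/subsetP => _ /imsetP[[[x z] y] + ->].
rewrite !inE /= => /andP[/(subsetP DXZ)] /[!inE] /= /andP[xX zZ] yY.
by rewrite /h /= !mem_diffset.
Qed.

(** Petridis's form of the Pluennecke inequality.  Take [X] to minimize
    [|X + B| / |X|] among the nonempty subsets of [A]; adding the elements of [Z]
    one at a time preserves the inequality [|X + B + Z| / |X + Z| <= |X + B| / |X|]. *)
Lemma petridis A B : A != set0 ->
  exists X, [/\ X \subset A, X != set0,
    (#|sumset X B| * #|A| <= #|sumset A B| * #|X|)%N &
    forall Z, (#|sumset (sumset X B) Z| * #|X| <= #|sumset X B| * #|sumset X Z|)%N].
Proof.
move=> A0.
(* the minimality of the ratio, cleared of denominators *)
have [X [XA X0 Xmin]] : exists X, [/\ X \subset A, X != set0 &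
    forall Y, Y \subset A -> (#|sumset X B| * #|Y| <= #|sumset Y B| * #|X|)%N].
  pose r Y : rat := #|sumset Y B|%:R / #|Y|%:R.
  pose P Y := (Y \subset A) && (Y != set0).
  have PA : P A by rewrite /P subxx.
  case: (@arg_minP _ _ _ A P r PA) => X /andP[XA X0] Xmin.
  exists X; split=> // Y YA; have [->|Y0] := eqVneq Y set0; first by rewrite cards0 muln0.
  have := Xmin Y; rewrite /P YA Y0 => /(_ isT); rewrite /r.
  by rewrite ler_pdivrMr ?ltr0n ?card_gt0 // mulrAC ler_pdivlMr ?ltr0n ?card_gt0 // -!natrM ler_nat.
exists X; split => // [|Z]; first by apply: Xmin.
have [n] := ubnP #|Z|; elim: n Z => // n IH Z; rewrite ltnS => Zn.
have [->|/set0Pn[z zZ]] := eqVneq Z set0.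
  suff -> : sumset (sumset X B) set0 = set0 by rewrite cards0.
  by apply/setP => x; rewrite inE; apply/negP => /sumsetP[? [? []]]; rewrite inE.
pose Z' := Z :\ z.
have /IH IHZ : (#|Z'| < n)%N by rewrite (cardsD1 z Z) zZ in Zn.
(* [W] collects the [x] such that [x + z] is not new in [X + Z], and [Y] those
   such that [x + B + z] is not new in [X + B + Z]; clearly [W] is in [Y] *)
pose W := [set x in X | x + z \in sumset X Z'].
pose Y := [set x in X | [forall b in B, x + b + z \in sumset (sumset X B) Z']].
have WY : W \subset Y.
  apply/subsetP => x; rewrite !inE => /andP[-> /sumsetP[x' [z' [x'X z'Z e]]]] /=.
  apply/forall_inP => b bB; rewrite addrAC e addrAC mem_sumset // mem_sumset //.
have YX : Y \subset X by apply/subsetP => x; rewrite inE => /andP[].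
have ZE : Z = z |: Z' by rewrite setD1K.
have tr (T : {set V}) : [set x + z | x in T] = sumset T [set z].
  apply/setP => x; apply/imsetP/sumsetP => [[t tT ->]|[t [y [tT /set1P -> ->]]]].
    by exists t, z; rewrite inE.
  by exists t.
have splitZ T : sumset T Z = sumset T Z' :|: sumset T [set z].
  apply/setP => x; rewrite inE; apply/sumsetP/orP.
    move=> [t [y [tT]]]; rewrite ZE => /setU1P[->|yZ] ->.
      by right; rewrite mem_sumset ?inE.
    by left; rewrite mem_sumset.
  move=> [] /sumsetP[t [y [tT yZ ->]]]; exists t, y; split => //; rewrite ZE.
    by apply/setU1P; right.
  by apply/setU1P; left; apply/set1P.
have c1 T : #|sumset T [set z]| = #|T|.
  by rewrite -tr; apply: card_imset; exact: addIr.
have e1 : (#|sumset X Z| + #|W| = #|sumset X Z'| + #|X|)%N.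
  rewrite splitZ -[X in _ = (_ + X)%N]c1 -[RHS]cardsUI; congr (_ + _)%N.
  rewrite -(card_imset W (addIr z)); apply: eq_card => y; rewrite inE.
  apply/imsetP/andP => [[x /[!inE] /andP[xX xz] ->]|].
    by rewrite xz mem_sumset ?inE.
  by move=> [yZ] /sumsetP[x [_ [xX /set1P -> e]]]; exists x; rewrite // inE xX -e.
have e2 : (#|sumset (sumset X B) Z| + #|sumset Y B| <=
           #|sumset (sumset X B) Z'| + #|sumset X B|)%N.
  rewrite splitZ -(c1 (sumset X B)) -[leqRHS]cardsUI leq_add2l -(c1 (sumset Y B)).
  apply/subset_leq_card/subsetP => _ /sumsetP[_ [_ [/sumsetP[y [b [yY bB ->]]] /set1P -> ->]]].
  move: yY; rewrite !inE => /andP[yX /forall_inP/(_ b bB) ->] /=.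
  by rewrite mem_sumset ?inE // mem_sumset.
have := Xmin Y (subset_trans YX XA); have := subset_leq_card WY; move: IHZ e1 e2.
move: #|_| #|_| #|_| #|_| #|_| #|_| #|_| #|_| #|_|.
nia.
Qed.
End Sumsets.

(** * Dilates and the sum-product phenomenon *)

(** Two iterates of the Pluennecke inequality, with constants depending on
    |A + B| only. *)
Lemma plunnecke_sums (V : finZmodType) (A B : {set V}) (C : nat) :
  A != set0 -> #|sumset A B| <= C * #|A| ->
  #|sumset B B| <= C ^ 2 * #|A| /\ #|sumset B (sumset B B)| <= C ^ 3 * #|A|.
Proof.
move=> A0 AB; have [X [XA X0 XB XZ]] := petridis B A0.
have := subset_leq_card XA.
have := XZ B; have := XZ (sumset B B).
rewrite (sumsetA (sumset X B)) (sumsetA X).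
have : #|sumset B B| <= #|sumset (sumset X B) B|.
  by rewrite -sumsetA (sumsetC X); exact: leq_card_sumsetl.
have : #|sumset B (sumset B B)| <= #|sumset (sumset (sumset X B) B) B|.
  by rewrite -!sumsetA (sumsetC X); apply: leq_card_sumsetl.
move: A0 X0 AB XB; rewrite -!card_gt0.
move: #|A| #|X| #|sumset X B| #|sumset A B| #|sumset (sumset X B) B|.
move: #|sumset (sumset (sumset X B) B) B| #|sumset B B| #|sumset B _|.
move=> xb3 b2 b3 a x xb ab xb2 a0 x0 abC xbC b3x b2x h3 h2 xa.
have xb1 : xb <= C * x by rewrite -(leq_pmul2r a0); nia.
have xb2' : xb2 <= C ^ 2 * x.
  rewrite -(leq_pmul2r x0); apply: leq_trans h2 _.
  by have := leq_mul xb1 xb1; lia.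
have xb3' : xb3 <= C ^ 3 * x.
  rewrite -(leq_pmul2r x0); apply: leq_trans h3 _.
  by have := leq_mul xb1 xb2'; lia.
split.
  by apply: leq_trans b2x (leq_trans xb2' _); rewrite leq_mul2l xa orbT.
by apply: leq_trans b3x (leq_trans xb3' _); rewrite leq_mul2l xa orbT.
Qed.

Section Dilates.
Variable F : finFieldType.
Implicit Types (A B : {set F}) (x y : F).
Local Open Scope ring_scope.

(** The dilate x A. *)
Definition dilate x A : {set F} := [set x * a | a in A].

Lemma card_dilate x A : x != 0 -> #|dilate x A| = #|A|.
Proof. by move=> x0; apply: card_imset; exact: mulfI. Qed.

Lemma dilateM x y A : dilate x (dilate y A) = dilate (x * y) A.
Proof. by rewrite /dilate -imset_comp; apply: eq_imset => a /=; rewrite mulrA. Qed.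

Lemma dilate1 A : dilate 1 A = A.
Proof.
by rewrite /dilate -[RHS]imset_id; apply: eq_imset => a; rewrite mul1r.
Qed.

Lemma dilateN1 A : dilate (-1) A = oppset A.
Proof. by apply: eq_imset => a; rewrite mulN1r. Qed.

Lemma dilate_diff x A B : dilate x (diffset A B) = diffset (dilate x A) (dilate x B).
Proof.
apply/setP => z; apply/imsetP/diffsetP => [[_ /diffsetP[a [b [aA bB ->]]] ->]|].
  by exists (x * a), (x * b); rewrite !imset_f // mulrBr.
move=> [_ [_ [/imsetP[a aA ->] /imsetP[b bB ->] ->]]].
by exists (a - b); rewrite ?mem_diffset // mulrBr.
Qed.

Lemma card_diffset_dilate x A B : x != 0 ->
  #|diffset (dilate x A) (dilate x B)| = #|diffset A B|.
Proof. by move=> x0; rewrite -dilate_diff card_dilate. Qed.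

(** The ratio [x] satisfies |A - x A| <= C |A|.  For [A] fixed, such ratios are
    closed under the field operations, at the cost of a power of [C]. *)
Definition small_dilate A (C : nat) x := (#|diffset A (dilate x A)| <= C * #|A|)%N.

Lemma small_dilate_leq A C C' x : (C <= C')%N -> small_dilate A C x -> small_dilate A C' x.
Proof. by move=> CC h; apply: leq_trans h _; rewrite leq_mul2r CC orbT. Qed.

Lemma small_dilate0 A C : (0 < C)%N -> small_dilate A C 0.
Proof.
move=> C0; apply: (@leq_trans #|A|); last by rewrite leq_pmull.
apply/subset_leq_card/subsetP => _ /diffsetP[a [_ [aA /imsetP[b _ ->] ->]]].
by rewrite mul0r subr0.
Qed.

Lemma small_dilateM A C C' x y : A != set0 -> (0 < C * C')%N ->
  small_dilate A C x -> small_dilate A C' y -> small_dilate A (C * C') (x * y).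
Proof.
move=> A0 CC hx hy; have [->|x0] := eqVneq x 0; first by rewrite mul0r; exact: small_dilate0.
have := ruzsa_triangle A (dilate x A) (dilate (x * y) A).
rewrite -[dilate (x * y) A]dilateM card_diffset_dilate // card_dilate //.
move=> h; rewrite /small_dilate -dilateM.
have a0 : (0 < #|A|)%N by rewrite card_gt0.
rewrite -(leq_pmul2r a0); apply: leq_trans h _.
by have := leq_mul hx hy; lia.
Qed.

Lemma small_dilateV A C x : (0 < C)%N -> small_dilate A C x -> small_dilate A C x^-1.
Proof.
have [->|x0] := eqVneq x 0; first by rewrite invr0.
move=> _; rewrite /small_dilate -(@card_diffset_dilate x A (dilate x^-1 A)) // dilateM mulfV //.
by rewrite dilate1 card_diffsetC.
Qed.

Lemma card_sumset_small A C : A != set0 -> small_dilate A C 1 -> (#|sumset A A| <= C ^ 2 * #|A|)%N.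
Proof.
move=> A0; rewrite /small_dilate dilate1 -sumset_oppr => /(plunnecke_sums A0)[+ _].
by rewrite -oppset_sum card_oppset.
Qed.

Lemma small_dilateN1 A C : A != set0 -> small_dilate A C 1 -> small_dilate A (C ^ 2) (-1).
Proof.
by move=> A0 /(card_sumset_small A0); rewrite /small_dilate dilateN1 diffset_oppr.
Qed.

Lemma sumsetUr A B1 B2 : sumset A (B1 :|: B2) = sumset A B1 :|: sumset A B2.
Proof.
apply/setP => z; rewrite inE; apply/sumsetP/orP.
  by move=> [x [y [xA /setUP[yB|yB] ->]]]; [left|right]; rewrite mem_sumset.
by move=> [] /sumsetP[x [y [xA yB ->]]]; exists x, y; rewrite inE yB ?orbT.
Qed.

(** The sum of two ratios: bounding |A - x A - y A| directly would require a
    Pluennecke inequality with distinct summands; instead all three summands are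
    put in one set [B], for which [|A + B|] is small, and [A - x A - y A] is
    contained in [B + B + B]. *)
Lemma small_dilateD A C x y : A != set0 -> (1 < C)%N -> small_dilate A C 1 ->
  small_dilate A C x -> small_dilate A C y -> small_dilate A (C ^ 9) (x + y).
Proof.
move=> A0 C1 h1 hx hy.
pose B := A :|: (oppset (dilate x A) :|: oppset (dilate y A)).
have AB : (#|sumset A B| <= C ^ 3 * #|A|)%N.
  rewrite /B !sumsetUr !sumset_oppr.
  apply: leq_trans (leq_card_setU _ _) _.
  have := (leq_card_setU (diffset A (dilate x A)) (diffset A (dilate y A))).1.
  have := card_sumset_small A0 h1; move: hx hy; rewrite /small_dilate.
  have : (C ^ 2 + 2 * C <= C ^ 3)%N by nia.
  by move=> /(leq_mul (leqnn #|A|)); lia.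
have [_ ] := plunnecke_sums A0 AB; rewrite -expnM; apply: leq_trans.
apply/subset_leq_card/subsetP => _ /diffsetP[a [_ [aA /imsetP[b bA ->] ->]]].
rewrite mulrDl opprD; apply: mem_sumset; first by rewrite inE aA.
by apply: mem_sumset; rewrite !inE; apply/or3P; [apply: Or32|apply: Or33];
  apply/imset_f/imset_f.
Qed.

(** Few ratios have small dilates.  For each one the additive energy of [A] and
    [x A] is at least |A|^3 / C, while a quadruple of elements of [A] other than
    a trivial one solves [a - x b = a' - x b'] for at most one [x]. *)
Lemma card_small_dilates A C (H : {set F}) : A != set0 ->
  {in H, forall x, small_dilate A C x} -> (#|H| * #|A| <= C * (#|A| ^ 2 + #|H|))%N.
Proof.
move=> A0 hH; have a0 : (0 < #|A|)%N by rewrite card_gt0.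
pose E x := [set q : (F * F) * (F * F) |
  [&& q.1 \in setX A A, q.2 \in setX A A & q.1.1 - x * q.1.2 == q.2.1 - x * q.2.2]].
have hE x : x \in H -> (#|A| ^ 3 <= C * #|E x|)%N.
  move=> /hH hx; rewrite -(leq_pmul2l a0) -expnS.
  have := collisions (setX A A) (fun q => q.1 - x * q.2).
  rewrite cardsX -/(E x) mulnn -expnM => h; apply: leq_trans h _.
  rewrite mulnA; apply: leq_mul => //; rewrite mulnC; apply: leq_trans hx.
  apply/subset_leq_card/subsetP => _ /imsetP[[a b] /[!inE] /= /andP[aA bA] ->].
  by rewrite mem_diffset ?imset_f.
have : (\sum_(x in H) #|E x| <= #|H| * #|A| ^ 2 + #|A| ^ 4)%N.
  rewrite -(card_pair_sum H E); set Q := [set _ | _].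
  pose Q1 := [set q in Q | q.2.1.2 == q.2.2.2].
  have -> : Q = Q1 :|: (Q :\: Q1).
    by apply/setP => q; rewrite !inE; case: (_ && _); case: eqP.
  apply: leq_trans (leq_card_setU _ _) _; apply: leq_add.
    have inj : {in Q1 &, injective (fun q : F * ((F * F) * (F * F)) => (q.1, q.2.1))}.
      move=> [x [[a b] [a' b']]] [y [[c d] [c' d']]]; rewrite !inE /=.
      move=> /andP[/and4P[_ _ _ /eqP e1] /eqP e2] /andP[/and4P[_ _ _ /eqP e3] /eqP e4].
      move=> [? ? ?]; subst; subst; congr (_, (_, (_, _))).
      by move: e1 e3 => /addIr <- /addIr <-.
    have -> : (#|H| * #|A| ^ 2)%N = #|setX H (setX A A)| by rewrite !cardsX mulnn.
    rewrite -(card_in_imset inj); apply/subset_leq_card/subsetP => _ /imsetP[q + ->].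
    by rewrite !inE /= => /andP[/and3P[-> /andP[-> ->]]].
  have inj : {in Q :\: Q1 &, injective (fun q : F * ((F * F) * (F * F)) => q.2)}.
    move=> [x [[a b] [a' b']]] [y [[c d] [c' d']]]; rewrite !inE /=.
    move=> /andP[+ /and4P[xH h1 h2 /eqP e1]]; rewrite xH h1 h2 e1 eqxx /= => bb.
    move=> /andP[_ /and4P[_ _ _ /eqP e2]] [? ? ? ?]; subst; congr (_, _).
    have bb' : d - d' != 0 by rewrite subr_eq0.
    apply: (mulIf bb'); rewrite !mulrBr.
    have -> : x * d - x * d' = c - c' - ((c - x * d) - (c' - x * d')) by ring.
    have -> : y * d - y * d' = c - c' - ((c - y * d) - (c' - y * d')) by ring.
    by rewrite e1 e2 !subrr.
  have -> : (#|A| ^ 4)%N = #|setX (setX A A) (setX A A)|.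
    by rewrite !cardsX; lia.
  rewrite -(card_in_imset inj); apply/subset_leq_card/subsetP => _ /imsetP[q + ->].
  by rewrite !inE /= => /andP[_ /and3P[_ -> /andP[-> _]]].
move=> hsum.
have : (#|H| * #|A| ^ 3 <= C * (#|H| * #|A| ^ 2 + #|A| ^ 4))%N.
  apply: leq_trans (leq_mul (leqnn C) hsum).
  by rewrite big_distrr /= -sum_nat_const; apply: leq_sum => x /hE.
move=> h; rewrite -(@leq_pmul2r (#|A| ^ 2)) ?expn_gt0 ?a0 //; lia.
Qed.

(** The only place where the primality of the field matters.  The ratios
    [Q = (O - O) / (O - O)] are all good.  If [Q] is not the whole field then,
    since [1] generates the additive group, there is [x] in [Q] with [x + 1] not
    in [Q]; then the elements [a + (x + 1) b], for [a] and [b] in [O], are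
    pairwise distinct, and they are good ratios as well.  If [Q] is the whole
    field, then every element is a good ratio. *)
Lemma sum_product_growth A (O : {set F}) (C : nat) :
  (forall x : F, exists n, x = n%:R) ->
  A != set0 -> O != set0 -> (1 < C)%N -> small_dilate A C 1 ->
  {in O, forall x, small_dilate A C x} ->
  exists H : {set F}, (#|H| = #|F| \/ #|H| = (#|O| ^ 2)%N) /\
    {in H, forall x, small_dilate A (C ^ (487 * 9)) x}.
Proof.
move=> primeF A0 O0 C1 h1 hO.
have C0 k : (0 < C ^ k)%N by rewrite expn_gt0 (ltnW C1).
have Cle k l : (k <= l)%N -> (C ^ k <= C ^ l)%N by move=> kl; rewrite leq_exp2l.
have up k l x : (k <= l)%N -> small_dilate A (C ^ k) x -> small_dilate A (C ^ l) x.
  by move=> kl; apply/small_dilate_leq/Cle.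
have h1k k : (0 < k)%N -> small_dilate A (C ^ k) 1 by move=> k0; apply: (@up 1).
have mul k l x y : small_dilate A (C ^ k) x -> small_dilate A (C ^ l) y ->
    small_dilate A (C ^ (k + l)) (x * y).
  by move=> hx hy; rewrite expnD; apply: small_dilateM; rewrite // -expnD.
have add k x y : (0 < k)%N -> small_dilate A (C ^ k) x -> small_dilate A (C ^ k) y ->
    small_dilate A (C ^ (k * 9)) (x + y).
  move=> k0 hx hy; rewrite expnM; apply: small_dilateD => //; last exact: h1k.
  by rewrite (leq_trans C1) // -[X in (X <= _)%N]expn1 Cle.
have sub x y : x \in O -> y \in O -> small_dilate A (C ^ 27) (x - y).
  move=> /hO hx /hO hy; apply: (add 3%N) => //; first exact: (@up 1).
  by rewrite -mulN1r; apply: (mul 2 1)%N => //; exact: small_dilateN1.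
pose Q : {set F} := [set (q.1.1 - q.1.2) / (q.2.1 - q.2.2) | q : (F * F) * (F * F) in setX (setX O O) (setX O O)].
have hQ x : x \in Q -> small_dilate A (C ^ 54) x.
  move=> /imsetP[[[a b] [c d]]]; rewrite !inE /= => /andP[/andP[aO bO] /andP[cO dO]] ->.
  by apply: (mul 27 27)%N; rewrite ?small_dilateV // sub.
have [QT|[x xQ x1Q]] : (Q = setT) \/ (exists2 x, x \in Q & x + 1 \notin Q).
  case: (boolP [exists x in Q, x + 1 \notin Q]) => [/exists_inP[x] ? ?|].
    by right; exists x.
  move=> /exists_inPn h; left; apply/setP => x; rewrite inE.
  have [n ->] := primeF x; elim: n => [|n IH].
    have /set0Pn[o oO] := O0; apply/imsetP.
    by exists ((o, o), (o, o)); rewrite ?inE /= ?oO // subrr mul0r.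
  by rewrite -[n.+1]addn1 natrD; have := h _ IH; rewrite negbK.
  exists setT; split; first by left; rewrite cardsT.
  by move=> x _; apply: (@up 54) => //; apply: hQ; rewrite QT inE.
exists [set w.1 + (x + 1) * w.2 | w : F * F in setX O O]; split.
  right; rewrite card_in_imset ?cardsX ?mulnn // => -[a b] [c d].
  rewrite !inE /= => /andP[aO bO] /andP[cO dO] e.
  have [bd|bd] := eqVneq b d.
    by move: e; rewrite bd => /addIr ->.
  case/negP: x1Q; apply/imsetP; exists ((a, c), (d, b)); rewrite ?inE /= ?aO ?bO ?cO ?dO //.
  have db : d - b != 0 by rewrite subr_eq0 eq_sym.
  apply: (mulIf db); rewrite /= divfK // {db}.
  by have -> : a - c = a + (x + 1) * b - c - (x + 1) * b by [ring]; rewrite e; ring.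
move=> _ /imsetP[[a b] /[!inE] /= /andP[aO bO] ->].
apply: (add 487%N) => //; first by apply: (@up 1) => //; apply: hO.
apply: (mul 486 1)%N; last exact: hO.
by apply: (add 54%N) => //; [exact: hQ|exact: h1k].
Qed.
End Dilates.

(** * The Balog-Szemeredi-Gowers theorem *)

Section Paths.
Variables I J : finType.
Implicit Types (A : {set I}) (B : {set J}) (G : I -> J -> bool).

(** The middle vertices of the paths [a - b1 - a1 - b] of length three in the
    bipartite graph [G] between [A] and [B]. *)
Definition paths3 G A B (a : I) (b : J) : {set J * I} :=
  [set q : J * I | [&& q.1 \in B, q.2 \in A, G a q.1, G q.2 q.1 & G q.2 b]].

(** The graph-theoretic core of the Balog-Szemeredi-Gowers theorem.  A suitable
    neighbourhood [U] contains few pairs with few common neighbours; after removal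
    of the vertices lying in many such pairs, every remaining vertex [a] has many
    common neighbours with most of the others, in particular with most of the
    neighbours of any vertex [b] that sees a fair share of what remains. *)
Lemma many_paths3 G A B (D K : nat) : 1 < K -> 0 < D -> #|A| <= D -> #|B| <= D ->
  D ^ 2 <= K * \sum_(a in A) \sum_(b in B) G a b ->
  exists A' B', [/\ A' \subset A, B' \subset B, D <= K ^ 4 * #|A'|, D <= K ^ 3 * #|B'| &
    forall a b, a \in A' -> b \in B' -> D ^ 2 <= K ^ 19 * #|paths3 G A B a b|].
Proof.
move=> K1 D0 AD BD dense.
pose deg a := \sum_(b in B) G a b.
pose A1 := [set a in A | D <= 2 * K * deg a].
have A1A : A1 \subset A by apply/subsetP => a; rewrite inE => /andP[].
have dense1 : D ^ 2 <= 2 * K * \sum_(b in B) \sum_(a in A1) G a b.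
  rewrite exchange_big -[leqRHS]/(2 * K * \sum_(a in A1) deg a).
  have : 2 * K * \sum_(a in A) deg a <= 2 * K * \sum_(a in A1) deg a + D ^ 2.
    apply: (@leq_trans (\sum_(a in A) ((a \in A1) * (2 * K * deg a) + D))).
      rewrite big_distrr /=; apply: leq_sum => a aA.
      by rewrite inE aA /=; case: (leqP D (2 * K * deg a)) => /= h; lia.
    rewrite big_split /= sum_nat_const; apply: leq_add; last by rewrite expnS expn1 leq_mul.
    rewrite big_distrr /= [leqRHS]big_mkcond /= [leqLHS]big_mkcond /=.
    by apply: leq_sum => a _; case: ifP => // _; case: (a \in A1); rewrite ?mul1n ?mul0n.
  by rewrite -[leqRHS]/(K * \sum_(a in A) deg a) in dense; lia.
pose n b := \sum_(a in A1) G a b.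
pose co a a' := \sum_(b in B) (G a b && G a' b).
(* a pair is bad if it has fewer than [D / L] common neighbours *)
pose L := 256 * K ^ 3.
pose bad a a' := L * co a a' < D.
pose nbad b := \sum_(a in A1) \sum_(a' in A1) (G a b && G a' b && bad a a').
have [b0 b0B] : exists b, b \in B.
  apply/set0Pn; apply/eqP => B0; move: dense1; rewrite B0 big_set0; nia.
(* averaging over [b] yields a neighbourhood that is large and has few bad
   pairs, both at once *)
have [b bB hb] : exists2 b, b \in B & D ^ 2 + L * nbad b <= 8 * K ^ 2 * n b ^ 2.
  apply: (exists_average b0B); rewrite big_split /= -!big_distrr /= sum_nat_const.
  have hn := cauchy_schwarz B n.
  have hbad : L * \sum_(b in B) nbad b <= D ^ 3.
    rewrite exchange_big big_distrr /=.
    apply: (@leq_trans (\sum_(a in A1) \sum_(a' in A1) D)); last first.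
      rewrite !sum_nat_const; have hA1 := leq_trans (subset_leq_card A1A) AD.
      by have := leq_mul hA1 (leq_mul hA1 (leqnn D)); lia.
    apply: leq_sum => a _; rewrite exchange_big big_distrr /=; apply: leq_sum => a' _.
    rewrite -[X in L * X](_ : (bad a a') * co a a' = _).
      by rewrite /bad; case: ltnP => /= h; lia.
    by rewrite /co big_distrr /=; apply: eq_bigr => b _; case: (bad a a'); rewrite ?mul1n ?mul0n ?andbT ?andbF.
  rewrite -[leqRHS]/(2 * K * \sum_(b in B) n b) in dense1.
  move: dense1 hn hbad.
  move: (\sum_(b in B) n b) (\sum_(b in B) n b ^ 2) (\sum_(b in B) nbad b) => s s2 sb h1 h2 h3.
  have h4 : s ^ 2 <= D * s2 by apply: leq_trans h2 _; rewrite leq_mul2r BD orbT.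
  have h5 : D * D ^ 3 <= D * (4 * K ^ 2 * s2).
    by have := leq_mul h1 h1; have := leq_mul (leqnn (4 * K ^ 2)) h4; lia.
  rewrite leq_pmul2l // in h5.
  have := leq_mul BD (leqnn (D ^ 2)); lia.
pose U := [set a in A1 | G a b].
have UE : #|U| = n b by rewrite card_set_sum.
pose bp a := \sum_(a' in U) bad a a'.
have bpE : nbad b = \sum_(a in U) bp a.
  rewrite /nbad.
  have -> : \sum_(a in U) bp a = \sum_(a in A1) (G a b) * bp a.
    rewrite /U; rewrite (eq_bigl (fun a => (a \in A1) && G a b)) => [|a]; last by rewrite inE.
    by rewrite big_mkcondr; apply: eq_bigr => a _; case: (G a b); rewrite ?mul1n ?mul0n.
  apply: eq_bigr => a _; rewrite /bp big_distrr /=.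
  rewrite [RHS](eq_bigl (fun a => (a \in A1) && G a b)) => [|a']; last by rewrite inE.
  rewrite big_mkcondr /=; apply: eq_bigr => a' _.
  by case: (G a b); case: (G a' b); case: (bad a a').
have n0 : 0 < n b by nia.
pose A2 := [set a in U | 32 * K * bp a <= 2 * n b].
have A2U : A2 \subset U by apply/subsetP => a; rewrite inE => /andP[].
have hA2 : n b <= 2 * #|A2|.
  have : \sum_(a in U) (2 * n b) <= \sum_(a in U) ((a \in A2) * (2 * n b) + 32 * K * bp a).
    apply: leq_sum => a aU; rewrite inE aU /=.
    by case: (leqP (32 * K * bp a) (2 * n b)) => /= h; lia.
  have -> : \sum_(a in U) ((a \in A2) * (2 * n b) + 32 * K * bp a) =
            (\sum_(a in U) (a \in A2)) * (2 * n b) + 32 * K * nbad b.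
    by rewrite big_split bpE; congr (_ + _); [rewrite big_distrl|rewrite big_distrr].
  rewrite sum_nat_const UE.
  have -> : \sum_(a in U) (a \in A2) = #|A2|.
    rewrite -card_set_sum; apply: eq_card => a.
    by rewrite [in LHS]inE; apply: andb_idl => /(subsetP A2U).
  have : 32 * K * nbad b <= n b ^ 2.
    rewrite -(@leq_pmul2l (8 * K ^ 2)); last by nia.
    rewrite /L in hb; lia.
  move=> h1 h2; rewrite -(leq_pmul2r n0); lia.
have A20 : 0 < #|A2| by lia.
pose n2 b := \sum_(a in A2) G a b.
pose B' := [set b in B | #|A2| <= 2 * (2 * K) * n2 b].
have hB' : D <= 2 * (2 * K) * #|B'|.
  apply: (@popular _ B n2 D #|A2| (2 * K)) => //.
    by move=> c _; rewrite /n2 -sum1_card; apply: leq_sum => a _; case: (G a c).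
  rewrite exchange_big big_distrr /= mulnC -sum_nat_const; apply: leq_sum => a.
  by move=> /(subsetP A2U); rewrite inE => /andP[]; rewrite inE => /andP[].
have hK i j : i <= j -> K ^ i <= K ^ j by move=> ij; rewrite leq_exp2l.
have k2 i : 2 ^ i <= K ^ i by case: i => // i; rewrite leq_exp2r.
have hD : D <= 6 * K * #|A2|.
  apply: (@leq_trans (3 * K * n b)).
    rewrite -(@leq_exp2r _ _ 2) //; apply: leq_trans (leq_trans (leq_addr _ _) hb) _.
    by rewrite !expnMn leq_mul2r; apply/orP; right; rewrite leq_mul2r orbT.
  by have := leq_mul (leqnn (3 * K)) hA2; lia.
exists A2, B'; split.
- by apply: subset_trans A2U _; apply/subsetP => a; rewrite inE => /andP[/(subsetP A1A)].
- by apply/subsetP => c; rewrite inE => /andP[].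
- apply: leq_trans hD _; rewrite leq_mul2r; apply/orP; right.
  by have := leq_mul (k2 3) (leqnn K); rewrite -expnSr; lia.
- apply: leq_trans hB' _; rewrite leq_mul2r; apply/orP; right.
  by have := leq_mul (k2 2) (leqnn K); rewrite -expnSr; lia.
move=> a c aA2; rewrite inE => /andP[cB hc].
have hbp : 8 * K * bp a <= #|A2|.
  by move: aA2; rewrite inE => /andP[_]; lia.
pose A3 := [set a1 in A2 | G a1 c && ~~ bad a a1].
have hA3 : #|A2| <= 8 * K * #|A3|.
  have : n2 c <= #|A3| + bp a.
    rewrite card_set_sum /bp.
    apply: (@leq_trans (\sum_(a1 in A2) (G a1 c && ~~ bad a a1) + \sum_(a1 in A2) bad a a1)).
      by rewrite -big_split /=; apply: leq_sum => a1 _; case: (G a1 c); case: (bad a a1).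
    rewrite leq_add2l [leqRHS](big_setID A2) /= (setIidPr A2U); exact: leq_addr.
  by move=> /(leq_mul (leqnn (8 * K))); lia.
have : \sum_(a1 in A3) co a a1 <= #|paths3 G A B a c|.
  rewrite (eq_bigr (fun a1 => #|[set b1 in B | G a b1 && G a1 b1]|)); last first.
    by move=> a1 _; rewrite card_set_sum.
  rewrite -(card_pair_sum A3 (fun a1 => [set b1 in B | G a b1 && G a1 b1])).
  have inj : injective (fun q : I * J => (q.2, q.1)) by move=> [? ?] [? ?] [-> ->].
  rewrite -(card_imset _ inj); apply/subset_leq_card/subsetP => _ /imsetP[[a1 b1] + ->].
  rewrite !inE /= => /andP[/andP[/andP[/andP[/andP[a1A _] _] _] /andP[-> _]] /and3P[-> -> ->]].
  by rewrite a1A.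
have : D * #|A3| <= L * \sum_(a1 in A3) co a a1.
  rewrite mulnC -sum_nat_const big_distrr /=; apply: leq_sum => a1.
  by rewrite inE => /and3P[_ _]; rewrite /bad -leqNgt.
move: (\sum_(_ in _) _) => s hs1 hs2.
apply: (@leq_trans (48 * 256 * K ^ 5 * #|paths3 G A B a c|)); last first.
  rewrite leq_mul2r; apply/orP; right.
  rewrite (_ : K ^ 19 = K ^ 14 * K ^ 5); last by rewrite -expnD.
  rewrite leq_mul2r; apply/orP; right.
  apply: (@leq_trans (2 ^ 6 * 2 ^ 8)); first by [].
  by rewrite (expnD K 6 8); apply: leq_mul; exact: k2.
have := leq_trans hs1 (leq_mul (leqnn L) hs2); move: hD hA3; rewrite /L; clear.
move: #|_| #|_| #|_| => a2 a3 q h1 h2 h3.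
have e1 := leq_mul (leqnn D) h1.
have e2 := leq_mul (leqnn (D * (6 * K))) h2.
have e3 := leq_mul (leqnn (48 * K ^ 2)) h3.
lia.
Qed.
End Paths.

(** The graph [G] has its differences [a - b] in a small set [W].  A path
    [a - b1 - a1 - b] writes [a - b] as [(a - b1) - (a1 - b1) + (a1 - b)], with
    three terms in [W], so a difference with many paths uses up many triples of
    elements of [W]. *)
Lemma balog_szemeredi_gowers (V : finZmodType) (A B W : {set V})
    (G : V -> V -> bool) (D K : nat) :
  1 < K -> 0 < D -> #|A| <= D -> #|B| <= D -> #|W| <= D ->
  D ^ 2 <= K * \sum_(a in A) \sum_(b in B) G a b ->
  (forall a b, a \in A -> b \in B -> G a b -> (a - b)%R \in W) ->
  exists A' B' : {set V}, [/\ A' \subset A, B' \subset B, D <= K ^ 19 * #|A'|,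
    D <= K ^ 19 * #|B'| & #|diffset A' B'| <= K ^ 19 * D].
Proof.
move=> K1 D0 AD BD WD dense GW.
have [A' [B' [AA BB cA cB paths]]] := many_paths3 K1 D0 AD BD dense.
have up i x : i <= 19 -> K ^ i * x <= K ^ 19 * x.
  by move=> i19; rewrite leq_mul2r leq_exp2l // i19 orbT.
exists A', B'; split => //; [exact: leq_trans cA (up _ _ _)|exact: leq_trans cB (up _ _ _)|].
have [S [SAB Sinj <-]] := imset_section (fun x : V * V => (x.1 - x.2)%R) (setX A' B').
rewrite -(@leq_pmul2r (D ^ 2)) ?expn_gt0 ?D0 //.
apply: (@leq_trans (K ^ 19 * #|setX W (setX W W)|)); last first.
  rewrite !cardsX -mulnA leq_mul2l; apply/orP; right.
  by have := leq_mul WD (leq_mul WD WD); rewrite -!expnS.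
apply: (@leq_trans (K ^ 19 * \sum_(x in S) #|paths3 G A B x.1 x.2|)).
  rewrite -sum_nat_const big_distrr /=; apply: leq_sum => x /(subsetP SAB).
  by rewrite inE => /andP[/paths]; apply.
rewrite leq_mul2l; apply/orP; right.
rewrite -(card_pair_sum S (fun x => paths3 G A B x.1 x.2)).
pose h (q : (V * V) * (V * V)) : V * (V * V) :=
  (q.1.1 - q.2.1, (q.2.2 - q.2.1, q.2.2 - q.1.2))%R.
rewrite -(@card_in_imset _ _ h).
  apply/subset_leq_card/subsetP => _ /imsetP[[[a b] [b1 a1]] + ->].
  rewrite !inE /= => /andP[/(subsetP SAB)]; rewrite !inE /= => /andP[aA bB].
  move=> /and5P[b1B a1A g1 g2 g3].
  by rewrite !GW // ?(subsetP AA) ?(subsetP BB).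
move=> [[a b] [b1 a1]] [[a' b'] [b1' a1']]; rewrite !inE /=.
move=> /andP[s _] /andP[s' _]; rewrite /h /= => -[e1 e2 e3].
have [ea eb] : (a, b) = (a', b').
  apply: Sinj => //=.
  have eq x y z t : (x - y = (x - z) - (t - z) + (t - y) :> V)%R.
    by rewrite opprB !subrKA.
  by rewrite (eq a b b1 a1) (eq a' b' b1' a1') e1 e2 e3.
subst; congr (_, (_, _)); first by move/addrI: e1 => /oppr_inj.
by move/addIr: e3.
Qed.

(** * One structured set for many slopes *)

(** Many large subsets of a common set: one of them meets many of the others in a
    large set. *)
Lemma popular_intersection (I J : finType) (L : {set I}) (P : I -> {set J})
    (X : {set J}) (M K : nat) (i0 : I) : i0 \in L -> 0 < M -> #|X| <= M ->
  {in L, forall i, P i \subset X} -> {in L, forall i, M <= K * #|P i|} ->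
  exists2 i, i \in L &
    #|L| <= 2 * K ^ 2 * #|[set j in L | M <= 2 * K ^ 2 * #|P i :&: P j|]|.
Proof.
move=> i0L M0 XM PX MP.
have hint i j : i \in L -> #|P i :&: P j| = \sum_(x in X) (x \in P i) * (x \in P j).
  move=> iL; rewrite (eq_bigr (fun x => (x \in P i :&: P j) : nat)); last first.
    by move=> x _; rewrite inE mulnb.
  rewrite -card_set_sum; apply: eq_card => x; rewrite inE andb_idl // inE => /andP[xP _].
  exact: (subsetP (PX i iL)).
have [i iL hi] : exists2 i, i \in L & #|L| * M <= K ^ 2 * \sum_(j in L) #|P i :&: P j|.
  apply: (exists_average i0L); rewrite sum_nat_const -[leqRHS](big_distrr (K ^ 2)) /=.
  pose r x := \sum_(i in L) (x \in P i).
  have er : \sum_(x in X) r x = \sum_(i in L) #|P i|.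
    rewrite exchange_big; apply: eq_bigr => i iL; rewrite -card_set_sum.
    by apply: eq_card => x; rewrite inE andb_idl // => /(subsetP (PX i iL)).
  have er2 : \sum_(x in X) r x ^ 2 = \sum_(i in L) \sum_(j in L) #|P i :&: P j|.
    under [RHS]eq_bigr => i iL do under eq_bigr => j _ do rewrite hint //.
    under [RHS]eq_bigr => i iL do rewrite exchange_big /=.
    rewrite exchange_big /=; apply: eq_bigr => x _; rewrite expnS expn1 big_distrl /=.
    by apply: eq_bigr => i _; rewrite big_distrr.
  have := cauchy_schwarz X r; rewrite er er2.
  have : #|L| * M <= K * \sum_(i in L) #|P i|.
    by rewrite big_distrr -sum_nat_const; apply: leq_sum => i /MP.
  move: (\sum_(i in L) \sum_(j in L) _) (\sum_(i in L) #|P i|) => s2 s h1 h2.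
  rewrite -(leq_pmul2r M0).
  have := leq_mul h1 h1; have := leq_mul (leqnn (K ^ 2)) (leq_trans h2 (leq_mul XM (leqnn s2))).
  lia.
exists i => //; apply: popular hi => // j jL.
by apply: leq_trans XM; apply/subset_leq_card/subIset; rewrite PX.
Qed.

Section Structure.
Variable F : finFieldType.
Local Open Scope ring_scope.

(** The Ruzsa triangle inequality for sets of size comparable to [D], with losses
    measured by powers of [k]. *)
Lemma ruzsa_chain (X Y Z : {set F}) (D k i j l : nat) : (0 < D)%N ->
  (#|diffset X Y| <= k ^ i * D)%N -> (#|diffset Y Z| <= k ^ j * D)%N ->
  (D <= k ^ l * #|Y|)%N -> (#|diffset X Z| <= k ^ (i + j + l) * D)%N.
Proof.
move=> D0 XY YZ DY; rewrite -(leq_pmul2r D0) !expnD.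
have := leq_mul (leqnn #|diffset X Z|) DY.
have := leq_mul (leqnn (k ^ l)) (leq_trans (ruzsa_triangle X Y Z) (leq_mul XY YZ)).
clear; move: #|diffset X Z| #|Y| (k ^ i)%N (k ^ j)%N (k ^ l)%N => x y u v w h1 h2; lia.
Qed.

(** The sets [A'] and [B'] depend on the slope [x].  A slope [x0] whose product
    [A' x B'] meets many of the others in a large set provides a single set [A0]
    with small dilates for all the ratios [x / x0]. *)
Lemma common_structure (A B L : {set F}) (D k : nat) :
  (1 < k)%N -> (0 < D)%N -> (#|A| <= D)%N -> (#|B| <= D)%N -> L != set0 -> 0 \notin L ->
  (forall x, x \in L -> exists A' B' : {set F}, [/\ A' \subset A, B' \subset B,
     (D <= k * #|A'|)%N, (D <= k * #|B'|)%N & (#|diffset A' (dilate x B')| <= k * D)%N]) ->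
  exists A0 O : {set F}, [/\ A0 \subset A, (D <= k * #|A0|)%N, (#|L| <= k ^ 5 * #|O|)%N,
    small_dilate A0 (k ^ 20) 1 & {in O, forall x, small_dilate A0 (k ^ 20) x}].
Proof.
move=> k1 D0 AD BD /set0Pn[l0 l0L] L0 hL.
have [f hf] : exists f : F -> {set F} * {set F}, forall x, x \in L ->
    [/\ (f x).1 \subset A, (f x).2 \subset B, (D <= k ^ 1 * #|(f x).1|)%N,
       (D <= k ^ 1 * #|(f x).2|)%N & (#|diffset (f x).1 (dilate x (f x).2)| <= k ^ 1 * D)%N].
  apply: (@fin_all_exists _ _ (fun x (u : {set F} * {set F}) => x \in L ->
    [/\ u.1 \subset A, u.2 \subset B, (D <= k ^ 1 * #|u.1|)%N,
       (D <= k ^ 1 * #|u.2|)%N & (#|diffset u.1 (dilate x u.2)| <= k ^ 1 * D)%N])) => x.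
  have [xL|_] := boolP (x \in L); last by exists (set0, set0).
  by have [A' [B' h]] := hL x xL; exists (A', B').
pose P x := setX (f x).1 (f x).2.
have [] := @popular_intersection _ _ L P (setX A B) (D ^ 2) (k ^ 2) l0 l0L.
- by rewrite expn_gt0 D0.
- by rewrite cardsX leq_mul.
- by move=> x /hf[fA fB _ _ _]; exact: setXS.
- by move=> x /hf[_ _ h1 h2 _]; rewrite cardsX; have := leq_mul h1 h2; lia.
move=> x0 x0L; set L' := [set _ in L | _] => cL.
have [A0A B0B cA0 cB0 AB0] := hf _ x0L.
set A0 := (f x0).1 in A0A cA0 AB0; set B0 := (f x0).2 in B0B cB0 AB0.
have nz x : x \in L -> x != 0 by apply: contraTneq => ->.
have cd x X : x \in L -> #|dilate x X| = #|X| by move=> /nz; exact: card_dilate.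
have small x : (#|diffset A0 (dilate x A0)| <= k ^ 19 * D)%N -> small_dilate A0 (k ^ 20) x.
  move=> h; apply: leq_trans h _; rewrite (expnD k 19 1) -mulnA leq_mul2l.
  by rewrite cA0 orbT.
have BA0 : (#|diffset (dilate x0 B0) A0| <= k ^ 1 * D)%N by rewrite card_diffsetC.
exists A0, [set x / x0 | x in L']; split => //.
- rewrite card_imset; last by apply: mulIf; rewrite invr_eq0 nz.
  apply: leq_trans cL _; rewrite leq_mul2r; apply/orP; right; nia.
- apply: small; rewrite dilate1.
  apply: leq_trans (@ruzsa_chain A0 (dilate x0 B0) A0 D k 1 1 1 _ _ _ _) _ => //.
    by rewrite cd.
  by rewrite leq_mul2r leq_exp2l // orbT.
move=> _ /imsetP[x /[!inE] /andP[xL cx] ->]; apply: small.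
have [Ax Bx cAx cBx ABx] := hf _ xL.
set A2 := (f x).1 :&: A0; set B2 := (f x).2 :&: B0.
have {}cx : (D ^ 2 <= k ^ 5 * (#|A2| * #|B2|))%N.
  apply: leq_trans cx _.
  have -> : P x0 :&: P x = setX A2 B2.
    by apply/setP => -[a b]; rewrite !inE /=; do 4![case: (_ \in _)].
  rewrite cardsX leq_mul2r; apply/orP; right; nia.
have A2D : (#|A2| <= D)%N.
  by apply: leq_trans AD; apply: subset_leq_card; rewrite subIset // A0A orbT.
have B2D : (#|B2| <= D)%N.
  by apply: leq_trans BD; apply: subset_leq_card; rewrite subIset // B0B orbT.
have cA2 : (D <= k ^ 5 * #|A2|)%N.
  rewrite -(leq_pmul2r D0).
  by have := leq_mul (leqnn (k ^ 5 * #|A2|)) B2D; lia.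
have cB2 : (D <= k ^ 5 * #|B2|)%N.
  rewrite -(leq_pmul2r D0).
  by have := leq_mul (leqnn (k ^ 5 * #|B2|)) A2D; lia.
have A0A2 : (#|diffset A0 A2| <= k ^ 3 * D)%N.
  apply: (@ruzsa_chain A0 (dilate x0 B0) A2 D k 1 1 1) => //; last by rewrite cd.
  by apply: leq_trans BA0; apply/subset_leq_card/diffsetS; rewrite // subsetIr.
have B2B0 : (#|diffset (dilate x B2) (dilate x B0)| <= k ^ 3 * D)%N.
  rewrite card_diffset_dilate ?nz // -(@card_diffset_dilate _ x0) ?nz //.
  apply: (@ruzsa_chain _ A0 _ D k 1 1 1) => //.
  by apply: leq_trans BA0; apply/subset_leq_card/diffsetS; rewrite // imsetS // subsetIr.
have A2B2 : (#|diffset A2 (dilate x B2)| <= k ^ 1 * D)%N.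
  apply: leq_trans ABx; apply/subset_leq_card/diffsetS; rewrite ?imsetS // subsetIl //.
have A2B0 : (#|diffset A2 (dilate x B0)| <= k ^ (1 + 3 + 5) * D)%N.
  by apply: ruzsa_chain D0 A2B2 B2B0 _; rewrite cd.
have A0B0 : (#|diffset A0 (dilate x B0)| <= k ^ (3 + (1 + 3 + 5) + 5) * D)%N.
  exact: ruzsa_chain D0 A0A2 A2B0 _.
apply: (@ruzsa_chain _ (dilate x B0) _ D k 17 1 1) => //; last by rewrite cd.
have -> : dilate x B0 = dilate (x / x0) (dilate x0 B0) by rewrite dilateM divfK ?nz.
by rewrite card_diffset_dilate // mulf_neq0 ?invr_eq0 ?nz.
Qed.
End Structure.

(** Double counting of the edges of [R] between [P] and [S]. *)
Lemma popular_neighbour (X T : finType) (P : {set X}) (S : {set T}) (R : X -> T -> bool)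
    (m k : nat) :
  (forall x, x \in P -> m <= k * #|[set t in S | R x t]|) ->
  m * #|P| <= k * \sum_(t in S) #|[set x in P | R x t]|.
Proof.
move=> h; rewrite mulnC -sum_nat_const.
under [in leqRHS]eq_bigr do rewrite card_set_sum.
rewrite exchange_big big_distrr; apply: leq_sum => x /h.
by rewrite card_set_sum.
Qed.

(** * The planar bound *)

Lemma exists_popular_neighbour (X T : finType) (P : {set X}) (S : {set T})
    (R : X -> T -> bool) (m k : nat) : 0 < m -> #|S| <= m -> P != set0 ->
  (forall x, x \in P -> m <= k * #|[set t in S | R x t]|) ->
  exists2 t, t \in S & #|P| <= k * #|[set x in P | R x t]|.
Proof.
move=> m0 Sm P0 h; have := popular_neighbour h.
have [t0 t0S] : exists t, t \in S.
  case/set0Pn: P0 => x /h hx.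
  have : 0 < #|[set t in S | R x t]| by case: #|_| hx => //; rewrite muln0 leqNgt m0.
  by move=> /card_gt0P[t]; rewrite inE => /andP[tS _]; exists t.
move=> hs.
have := @exists_average _ S (fun=> #|P|) (fun t => k * #|[set x in P | R x t]|) t0 t0S.
rewrite sum_nat_const -big_distrr /=; apply; apply: leq_trans hs.
by rewrite leq_mul2r Sm orbT.
Qed.

Section Plane.
Variable F : finFieldType.
Local Open Scope ring_scope.

(** The sum-product contradiction: [A] and [B], of size about the square root of
    |F|, cannot have additive structure for that many slopes unless [k] is at
    least a power of |F|. *)
Lemma slopes_bound (A B L : {set F}) (D m k : nat) :
  (forall x : F, exists n, x = n%:R) ->
  (1 < k)%N -> (0 < D)%N -> (#|F| <= m ^ 2)%N -> (D ^ 2 <= k * #|F|)%N ->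
  (m <= D)%N -> (m <= k * #|L|)%N ->
  (#|A| <= D)%N -> (#|B| <= D)%N -> L != set0 -> 0 \notin L ->
  (forall x, x \in L -> exists A' B' : {set F}, [/\ A' \subset A, B' \subset B,
     (D <= k * #|A'|)%N, (D <= k * #|B'|)%N & (#|diffset A' (dilate x B')| <= k * D)%N]) ->
  (#|F| <= k ^ ((20 * (487 * 9) + 15) * 2))%N.
Proof.
move=> primeF k1 D0 Fm DF mD mL AD BD L0 nL hL.
have [A0 [O [A0A cA0 cO s1 sO]]] := common_structure k1 D0 AD BD L0 nL hL.
have nzA0 : A0 != set0.
  by rewrite -card_gt0; case: #|A0| cA0 => //; rewrite muln0 leqNgt D0.
have nzO : O != set0.
  rewrite -card_gt0; case: #|O| cO => //; rewrite muln0 leqNgt card_gt0 L0 //.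
have k20 : (1 < k ^ 20)%N by rewrite (leq_trans k1) // -[X in (X <= _)%N]expn1 leq_exp2l.
have [H [cH sH]] := sum_product_growth primeF nzA0 nzO k20 s1 sO.
have := card_small_dilates nzA0 sH.
have {}cH : (#|F| <= k ^ 12 * #|H|)%N.
  case: cH => ->; first by rewrite leq_pmull // expn_gt0 (ltnW k1).
  apply: leq_trans Fm _; rewrite (expnM k 6 2) -expnMn leq_exp2r //.
  apply: leq_trans mL _; rewrite expnS -mulnA leq_mul2l; apply/orP; right.
  exact: cO.
set C := ((k ^ 20) ^ _)%N => hH.
rewrite expnM expnD expnM -/C.
have H0 : (0 < #|H|)%N.
  by case: #|H| cH => //; rewrite muln0 leqNgt (cardD1 0) inE.
have A0D : (#|A0| <= D)%N by apply: leq_trans AD; exact: subset_leq_card.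
have A2H : (#|A0| ^ 2 <= k ^ 13 * #|H|)%N.
  apply: (@leq_trans (D ^ 2)); first by rewrite leq_exp2r.
  apply: leq_trans DF _; rewrite (expnS k 12) -mulnA leq_mul2l; apply/orP; right.
  exact: cH.
have A0C : (#|A0| <= C * k ^ 14)%N.
  rewrite -(leq_pmul2l H0); apply: leq_trans hH _.
  apply: (@leq_trans (C * (k ^ 13 * #|H| + #|H|))).
    by rewrite leq_mul2l leq_add2r A2H orbT.
  rewrite mulnCA [(#|H| * _)%N]mulnC leq_mul2l; apply/orP; right.
  rewrite -mulSnr leq_mul2r; apply/orP; right.
  by rewrite ltn_exp2l.
apply: leq_trans Fm _; rewrite leq_exp2r //; apply: leq_trans mD (leq_trans cA0 _).
by rewrite (expnS k 14) mulnCA leq_mul2l A0C orbT.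
Qed.

(** The planar incidence bound.  The point [(X, Y)] is joined to [t] when the line
    of the pencil [t] through it, given by the value of [X - t Y], belongs to the
    family [V t].  Two pencils [t1] and [t2] provide coordinates; the third one is
    then a level set of [a - slope t * b], and its lines being few amounts to an
    additive structure for the slope [(t - t1) / (t - t2)]. *)
Lemma plane_bound (T : {set F}) (V : F -> {set F}) (P : {set F * F}) (m K : nat) :
  (forall x : F, exists n, x = n%:R) ->
  (1 < K)%N -> (#|T| <= m)%N -> (#|F| <= m ^ 2)%N -> (m ^ 2 <= 4 * #|F|)%N ->
  {in T, forall t, (#|V t| <= K * m)%N} -> (#|F| <= K * #|P|)%N ->
  {in P, forall x : F * F, (m <= K * #|[set t in T | (x.1 - t * x.2)%R \in V t]|)%N} ->
  (#|F| <= (K ^ 209) ^ ((20 * (487 * 9) + 15) * 2))%N.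
Proof.
move=> primeF K1 Tm Fm mF Vm FP hP.
have K0 : (0 < K)%N by exact: ltnW.
have hK i j : (i <= j)%N -> (K ^ i <= K ^ j)%N by move=> ij; rewrite leq_exp2l.
have k2 i : (2 ^ i <= K ^ i)%N by case: i => // i; rewrite leq_exp2r.
have F0 : (0 < #|F|)%N by apply/card_gt0P; exists 0.
have m0 : (0 < m)%N by case: (m) Fm => //; rewrite leqNgt F0.
have [mK|Km] := ltnP m (4 * K).
  apply: leq_trans Fm _; apply: (@leq_trans (K ^ 6)).
    rewrite (expnM K 3 2) leq_exp2r //; apply: leq_trans (ltnW mK) _.
    by rewrite expnSr leq_mul2r (k2 2%N) orbT.
  by rewrite -expnM; apply: hK; apply: leq_trans (@leq_pmulr 209 _ _).
pose R (x : F * F) t := x.1 - t * x.2 \in V t.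
have nzP : P != set0.
  by rewrite -card_gt0; case: #|P| FP => //; rewrite muln0 leqNgt F0.
have [t1 t1T] := exists_popular_neighbour m0 Tm nzP hP.
rewrite -/(R _ t1); set P1 := [set x in P | _] => cP1.
have nzP1 : P1 != set0.
  rewrite -card_gt0; case: #|P1| cP1 => //; rewrite muln0 leqNgt card_gt0 nzP //.
pose T1 := T :\ t1.
have dP1 : {in P1, forall x, (m <= K * (#|[set t in T1 | R x t]|).+1)%N}.
  move=> x; rewrite inE => /andP[/hP h Rx]; apply: leq_trans h _.
  rewrite leq_mul2l (cardsD1 t1); apply/orP; right; rewrite -add1n; apply: leq_add.
    exact: leq_b1.
  apply/subset_leq_card/subsetP => t; rewrite !inE => /and3P[-> -> h].
  exact: h.
have T1m : (#|T1| <= m)%N by apply: leq_trans Tm; exact: subset_leq_card (subD1set _ _).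
have [t2 t2T1] : exists2 t2, t2 \in T1 & (#|P1| <= 2 * K * #|[set x in P1 | R x t2]|)%N.
  apply: (exists_popular_neighbour m0) => // x /dP1.
  move: #|_| => d; rewrite mulnS; lia.
set P2 := [set x in P1 | _] => cP2.
have nzP2 : (0 < #|P2|)%N.
  by case: #|P2| cP2 => //; rewrite muln0 leqNgt card_gt0 nzP1.
pose T2 := T1 :\ t2.
have dP2 : {in P2, forall x, (m <= 2 * K * #|[set t in T2 | R x t]|)%N}.
  move=> x; rewrite inE => /andP[/dP1 h Rx].
  have : (#|[set t in T1 | R x t]| <= #|[set t in T2 | R x t]|.+1)%N.
    rewrite (cardsD1 t2) -add1n; apply: leq_add; first exact: leq_b1.
    apply/subset_leq_card/subsetP => t; rewrite !inE => /and3P[-> /andP[-> ->] h'].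
    exact: h'.
  rewrite -ltnS => /(leq_mul (leqnn K)) /(leq_trans h).
  move: #|_| => d; rewrite !mulnS; lia.
have T2m : (#|T2| <= m)%N by apply: leq_trans T1m; exact: subset_leq_card (subD1set _ _).
pose P3 t := [set x in P2 | R x t].
have := @popular _ T2 (fun t => #|P3 t|) m #|P2| (2 * K) nzP2 T2m _ (popular_neighbour dP2).
set T3 := [set t in T2 | _] => cT3.
have {}cT3 : (m <= 2 * (2 * K) * #|T3|)%N.
  by apply: cT3 => t _; apply/subset_leq_card/subsetP => x; rewrite inE => /andP[].
have t12 : t1 - t2 != 0.
  by move: t2T1; rewrite !inE subr_eq0 eq_sym => /andP[].
(* up to a constant factor, [X - t Y] is
   [(X - t1 Y) - slope t * (X - t2 Y)] *)
pose slope t := (t - t1) / (t - t2).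
have T3P t : t \in T3 -> [/\ t \in T, t - t1 != 0, t - t2 != 0 & (#|P2| <= 2 * (2 * K) * #|P3 t|)%N].
  by rewrite !inE !subr_eq0 => /andP[/and3P[-> -> ->] ->].
have slope_inj : {in T3 &, injective slope}.
  move=> t s /T3P[_ _ tt2 _] /T3P[_ _ st2 _] /eqP.
  rewrite /slope eqr_div // -subr_eq0.
  have -> : (t - t1) * (s - t2) - (s - t1) * (t - t2) = (t - s) * (t1 - t2) by ring.
  by rewrite mulf_eq0 (negPf t12) orbF subr_eq0 => /eqP.
have Km0 : (0 < K * m)%N by rewrite muln_gt0 K0.
have cL : #|slope @: T3| = #|T3| by apply: card_in_imset.
apply: (@slopes_bound (V t1) (V t2) (slope @: T3) (K * m) m (K ^ 209)) => //.
- by rewrite (leq_trans K1) // -[X in (X <= _)%N]expn1 hK.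
- apply: (@leq_trans (K ^ 4 * #|F|)); last by rewrite leq_mul2r hK ?orbT.
  rewrite expnMn (expnD K 2 2) -mulnA leq_mul2l; apply/orP; right.
  by apply: leq_trans mF _; rewrite leq_mul2r (k2 2%N) orbT.
- by rewrite leq_pmull.
- rewrite cL; apply: leq_trans cT3 _; rewrite leq_mul2r; apply/orP; right.
  apply: (@leq_trans (K ^ 3)); last exact: hK.
  by rewrite mulnA expnSr leq_mul2r (k2 2%N) orbT.
- exact: Vm.
- by apply: Vm; move: t2T1; rewrite inE => /andP[].
- by rewrite -card_gt0 cL; case: #|T3| cT3 => //; rewrite muln0 leqNgt m0.
- apply/negP => /imsetP[t /T3P[_ a b _] /esym/eqP].
  by rewrite mulf_eq0 invr_eq0 (negPf a) (negPf b).
move=> _ /imsetP[t tT3 ->]; have [tT tt1 tt2 cP3] := T3P t tT3.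
have s0 : slope t != 0 by rewrite mulf_neq0 ?invr_eq0.
pose phi (x : F * F) := (x.1 - t1 * x.2, slope t * (x.1 - t2 * x.2)).
have phi_inj : injective phi.
  move=> [x y] [x' y'] [e1 /(mulfI s0) e2].
  have ey : y = y'.
    apply: (mulIf t12).
    have -> : y * (t1 - t2) = x - t2 * y - (x - t1 * y) by ring.
    by rewrite /= in e1 e2; rewrite e1 e2; ring.
  by move: e1; rewrite ey => /= /addIr ->.
pose G a b := (a, b) \in phi @: P3 t.
pose W := dilate ((t1 - t2) / (t - t2)) (V t).
have [|||||||A' [B' [AA BB cA cB AB]]] :=
    @balog_szemeredi_gowers _ (V t1) (dilate (slope t) (V t2)) W G (K * m) (K ^ 11).
- by rewrite (leq_trans K1) // -[X in (X <= _)%N]expn1 hK.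
- by [].
- exact: Vm.
- by rewrite card_dilate // Vm //; move: t2T1; rewrite inE => /andP[].
- by rewrite card_dilate ?Vm // mulf_neq0 ?invr_eq0.
- apply: (@leq_trans (K ^ 11 * #|P3 t|)).
    apply: (@leq_trans (K ^ 2 * (4 * (K * (K * (2 * K * (2 * (2 * K) * #|P3 t|))))))).
      rewrite expnMn leq_mul2l; apply/orP; right; apply: leq_trans mF _.
      rewrite leq_mul2l /=; apply: leq_trans FP _; rewrite leq_mul2l; apply/orP; right.
      apply: leq_trans cP1 _; rewrite leq_mul2l; apply/orP; right.
      by apply: leq_trans cP2 _; rewrite leq_mul2l cP3 orbT.
    rewrite (_ : K ^ 11 = K ^ 5 * K ^ 6)%N; last by rewrite -expnD.
    have := leq_mul (k2 5%N) (leqnn (K ^ 6 * #|P3 t|)); clear.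
    move: #|_| => c; lia.
  rewrite leq_mul2l; apply/orP; right.
  rewrite -(card_imset _ phi_inj).
  under [leqRHS]eq_bigr do rewrite -card_set_sum.
  rewrite -(card_pair_sum (V t1) (fun a => [set b in dilate (slope t) (V t2) | G a b])).
  apply/subset_leq_card/subsetP => z zP; have /imsetP[x + ez] := zP.
  rewrite !inE => /andP[/andP[/andP[xP x1] x2] _].
  by rewrite /G -surjective_pairing zP ez /= x1 imset_f.
- move=> a b _ _ /imsetP[x]; rewrite inE => /andP[_ xt] [-> ->].
  apply/imsetP; exists (x.1 - t * x.2) => //.
  by rewrite /slope; field.
have sV : (slope t)^-1 != 0 by rewrite invr_eq0.
exists A', (dilate (slope t)^-1 B'); split => //.
- apply/subsetP => _ /imsetP[b /(subsetP BB)/imsetP[v vV ->] ->].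
  by rewrite mulKf.
- by rewrite (expnM K 11 19).
- by rewrite card_dilate // (expnM K 11 19).
- by rewrite dilateM mulfV // dilate1 (expnM K 11 19).
Qed.
End Plane.

(** * From lines in space to a plane *)

(** The lines are [y = b u + t u] in [F * F^k], one for each [u]; the pairwise
    distinct directions are the vectors [(1, u)].  On the line [u] a set [M u] of
    abscissas is marked. *)
Section Lines.
Variables (F : finFieldType) (k : nat).
Notation W := 'rV[F]_k.
Variables (b : W -> W) (M : W -> {set F}).
Local Open Scope ring_scope.

(** The point of abscissa [t] on the line [u]. *)
Definition point_at u t : F * W := (t, b u + t *: u).

(** [x] is a marked point of the line [u]. *)
Definition marked u (x : F * W) := (x.1 \in M u) && (x.2 == b u + x.1 *: u).

Lemma marked_point u t : marked u (point_at u t) = (t \in M u).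
Proof. by rewrite /marked /= eqxx andbT. Qed.

Lemma markedE u x : marked u x -> x = point_at u x.1.
Proof. by case: x => t y /andP[_ /eqP /= ->]. Qed.

Lemma line_unique u u' x y : marked u x -> marked u' x -> marked u y -> marked u' y ->
  x.1 != y.1 -> u = u'.
Proof.
case: x y => [s x] [t y] /andP[_ /eqP /= e1] /andP[_ /eqP /= e2].
move=> /andP[_ /eqP /= e3] /andP[_ /eqP /= e4] st.
have : (s - t) *: (u - u') == 0.
  have -> : (s - t) *: (u - u') = (b u + s *: u) - (b u + t *: u) -
     ((b u' + s *: u') - (b u' + t *: u')).
    by apply/rowP => i; rewrite !mxE; ring.
  by rewrite -e1 -e2 -e3 -e4 subrr.
by rewrite scaler_eq0 !subr_eq0 (negPf st) => /eqP.
Qed.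

Variables (S : {set F * W}) (m K : nat).
Hypothesis K1 : (1 < K)%N.
Hypothesis Mm : forall u, #|M u| = m.
Hypothesis MS : forall u t, t \in M u -> point_at u t \in S.
Hypothesis Fm : (#|F| <= m ^ 2)%N.
Hypothesis m4 : (4 <= m)%N.

Lemma card_marked u : #|[set x in S | marked u x]| = m.
Proof.
have inj : injective (point_at u) by move=> s t [].
rewrite -(Mm u) -(card_imset _ inj); apply: eq_card => x; rewrite inE.
apply/andP/imsetP => [[xS mx]|[t tM ->]]; last by rewrite MS // marked_point.
by exists x.1; [case/andP: mx|exact: markedE].
Qed.

(** The pairs [(u, t)] such that the line [u] meets the line [u0] at abscissa [t],
    at a point marked on both lines. *)
Definition crossings u0 : {set W * F} :=
  [set z | [&& z.2 \in M u0, z.1 != u0 & marked z.1 (point_at u0 z.2)]].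

(** Cauchy-Schwarz on the number of marked lines through each point.  If
    |S|^2 <= K |F|^(k+1), the average point lies on so many lines that the
    crossings of some line with the others number at least |S| / (2 K). *)
Lemma exists_crossed_line :
  (#|F| <= #|{: W}|)%N -> (#|S| ^ 2 <= K * (#|F| * #|{: W}|))%N -> (4 * K <= #|F|)%N ->
  exists u0, (#|S| <= 2 * K * #|crossings u0|)%N.
Proof.
move=> FW SK bigF; pose d x := (\sum_(u : W) marked u x)%N.
have sd : (\sum_(x in S) d x = #|{: W}| * m)%N.
  rewrite exchange_big /= -sum_nat_const; apply: eq_bigr => u _.
  by rewrite -card_set_sum card_marked.
have sd2 : (\sum_(x in S) d x ^ 2 <= \sum_(u0 : W) (m + #|crossings u0|))%N.
  have -> : (\sum_(x in S) d x ^ 2 =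
      \sum_(u0 : W) \sum_(u : W) \sum_(x in S) (marked u0 x && marked u x))%N.
    rewrite (eq_bigr (fun x => \sum_(u0 : W) \sum_(u : W) (marked u0 x && marked u x))%N).
      by rewrite exchange_big; apply: eq_bigr => u0 _; rewrite exchange_big.
    move=> x _; rewrite expnS expn1 big_distrl; apply: eq_bigr => u0 _ /=.
    by rewrite big_distrr; apply: eq_bigr => u _ /=; rewrite mulnb.
  apply: leq_sum => u0 _; rewrite (bigD1 u0) //=; apply: leq_add.
    by under eq_bigr do rewrite andbb; rewrite -card_set_sum card_marked.
  pose h (z : W * F) := (z.1, point_at u0 z.2).
  have inj : injective h by move=> [? ?] [? ?] [-> ->].
  rewrite -(card_imset _ inj).
  under eq_bigr do rewrite -card_set_sum.
  rewrite (eq_bigl (fun u => u \in [set~ u0])); last by move=> u; rewrite !inE.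
  rewrite -(card_pair_sum [set~ u0] (fun u => [set x in S | marked u0 x && marked u x])).
  apply/subset_leq_card/subsetP => -[u x]; rewrite !inE /= => /and4P[uu0 xS m0 mu].
  apply/imsetP; exists (u, x.1); rewrite ?inE /=.
    by rewrite uu0 -(markedE m0) mu; case/andP: m0 => ->.
  by rewrite /h /= -(markedE m0).
have cs := cauchy_schwarz S d; rewrite sd in cs.
have [u0 _ hu0] : exists2 u0 : W, u0 \in setT &
    (#|{: W}| * m ^ 2 <= #|S| * (m + #|crossings u0|))%N.
  apply: (@exists_average _ setT _ _ (0 : W)); first by rewrite inE.
  rewrite sum_nat_const cardsT -[leqRHS](big_distrr #|S|) /=.
  rewrite (eq_bigl predT) => [|u]; last by rewrite inE.
  apply: leq_trans (leq_mul (leqnn #|S|) sd2).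
  by apply: leq_trans cs; rewrite expnMn; lia.
exists u0; move: hu0 SK FW bigF Fm.
have : (0 < #|F|)%N by apply/card_gt0P; exists 0.
have K0 := K1; move: m4 K0; clear.
move: #|crossings u0| #|S| #|F| #|{: W}| => e N p q m4 K1 p0 h1 h2 h3 h4 h5.
(* each point lies on two marked lines at least on average, so that the
   diagonal term [m] is negligible *)
have small : (2 * N <= q * m)%N.
  rewrite -(@leq_exp2r _ _ 2) // !expnMn.
  have := leq_mul (leqnn 4) h2.
  have := leq_mul (leqnn (q * p)) h4.
  have := leq_mul (leqnn (q * p)) h3.
  have := leq_mul (leqnn (q * q)) h5.
  lia.
have {}h1 : (q * m ^ 2 <= 2 * N * e)%N.
  have := leq_mul small (leqnn m); lia.
have [->//|N0] := posnP N.
rewrite -(leq_pmul2l N0).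
have := leq_mul (leqnn K) h1.
have := leq_mul (leqnn (K * q)) h5.
lia.
Qed.

Section BaseLine.
Variable u0 : W.
Hypothesis Su0 : (#|S| <= 2 * K * #|crossings u0|)%N.

(** [x] is joined, by a line other than [u0] on which both points are marked, to
    the point of abscissa [t] of the line [u0]. *)
Definition joined (x : F * W) t :=
  [exists u, [&& u != u0, marked u x, marked u (point_at u0 t) & x.1 != t]].

(** The marked points of the line [u0] to which [x] is joined. *)
Definition nbhd x : {set F} := [set t in M u0 | joined x t].

(** The points of [S] that are joined to a proportion [1 / (8 K)] of the marked
    points of the line [u0]. *)
Definition rich_points := [set x in S | m <= 2 * (4 * K) * #|nbhd x|]%N.

Lemma card_rich_points : (#|S| <= 8 * K * #|rich_points|)%N.
Proof.
have : (#|S| * m <= 4 * K * \sum_(x in S) #|nbhd x|)%N.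
  have : (#|crossings u0| * m <= 2 * \sum_(x in S) #|nbhd x|)%N.
    apply: (@leq_trans (2 * (#|crossings u0| * m.-1))%N).
      by rewrite mulnCA leq_mul2l; apply/orP; right; move: m4; lia.
    rewrite leq_mul2l /=.
    have -> : (#|crossings u0| * m.-1 = \sum_(z in crossings u0) #|M z.1 :\ z.2|)%N.
      rewrite -sum_nat_const; apply: eq_bigr => -[u t]; rewrite inE /= => /and3P[_ _ /andP[tM _]].
      by rewrite -(Mm u) (cardsD1 t (M u)) tM.
    rewrite -(card_pair_sum _ (fun z : W * F => M z.1 :\ z.2)) -(card_pair_sum S nbhd).
    pose h (z : (W * F) * F) := (point_at z.1.1 z.2, z.1.2).
    rewrite -(@card_in_imset _ _ h).
      apply/subset_leq_card/subsetP => _ /imsetP[[[u t] s] + ->].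
      rewrite !inE /= => /andP[/and3P[tM uu0 mu] /andP[st sM]].
      rewrite MS // tM /=; apply/existsP; exists u.
      by rewrite uu0 marked_point sM mu st.
    move=> [[u t] s] [[u' t'] s']; rewrite !inE /=.
    move=> /andP[/and3P[tM uu0 mu] /andP[st sM]] /andP[/and3P[tM' uu0' mu'] /andP[st' sM']].
    move=> [es ep et]; subst.
    suff -> : u = u' by [].
    have mu's : marked u' (point_at u s') by rewrite /marked /= sM' ep eqxx.
    by apply: (line_unique _ mu's mu mu' st); rewrite marked_point.
  move=> h; have := leq_mul Su0 (leqnn m); have := leq_mul (leqnn (2 * K)) h.
  by clear; move: (\sum_(x in S) _)%N #|crossings u0| => s e; lia.
move=> h; have m0 : (0 < m)%N by apply: leq_trans m4.
have := @popular _ S (fun x => #|nbhd x|) #|S| m (4 * K) m0 (leqnn _) _ h.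
rewrite (_ : 8 * K = 2 * (4 * K))%N; last by rewrite mulnA.
apply => x _; rewrite -(Mm u0); apply/subset_leq_card/subsetP => t.
by rewrite inE => /andP[].
Qed.

(** The displacement from the line [u0] in the last [k] coordinates; it vanishes
    exactly on that line. *)
Definition height (x : F * W) : W := x.2 - (b u0 + x.1 *: u0).

Lemma heightE u x t : marked u x -> marked u (point_at u0 t) ->
  height x = (x.1 - t) *: (u - u0).
Proof.
move=> /andP[_ /eqP e1] /andP[_ /eqP /= e2]; rewrite /height e1.
have -> : b u = b u0 + t *: u0 - t *: u by rewrite e2 addrK.
by apply/rowP => i; rewrite !mxE; ring.
Qed.

(** The points of [S] in the plane spanned by [x] and the line [u0], without those
    on the line itself, for [x] not on that line. *)
Definition plane_class x : {set F * W} :=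
  [set y in S | (height y != 0) && [exists r, height y == r *: height x]].

Lemma plane_class_eq x y : y \in plane_class x -> plane_class y = plane_class x.
Proof.
rewrite inE => /and3P[_ y0 /existsP[r /eqP e]].
have r0 : r != 0 by apply: contraNneq y0 => r0; rewrite e r0 scale0r.
apply/setP => z; rewrite !inE; congr [&& _, _ & _].
apply/existsP/existsP => -[s /eqP ->].
  by exists (s * r); rewrite e scalerA.
by exists (s / r); rewrite e scalerA divfK.
Qed.

Lemma rich_points_height x : x \in rich_points -> height x != 0.
Proof.
rewrite inE => /andP[_ h].
have : (0 < #|nbhd x|)%N.
  by case: #|_| h => //; rewrite muln0 leqNgt (leq_trans _ m4).
move=> /card_gt0P[t]; rewrite inE => /andP[_ /existsP[u /and4P[uu0 mx mt xt]]].
by rewrite (heightE mx mt) scaler_eq0 !subr_eq0 negb_or xt.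
Qed.

(** The lines through a rich point [x] that meet the line [u0] all lie in the plane
    of [x] and intersect at [x] only, so that this plane contains, up to
    a factor of order [K], at least [m ^ 2] points of [S]. *)
Lemma bush x : x \in rich_points -> (#|F| <= 16 * K * #|plane_class x|)%N.
Proof.
move=> xr; have x0 := rich_points_height xr; move: xr; rewrite inE => /andP[xS hx].
pose E := [set z in crossings u0 | marked z.1 x && (x.1 != z.2)].
have NE : (#|nbhd x| <= #|E|)%N.
  apply: leq_trans (leq_imset_card snd E); apply/subset_leq_card/subsetP => t.
  rewrite inE => /andP[tM /existsP[u /and4P[uu0 mx mt xt]]].
  by apply/imsetP; exists (u, t); rewrite ?inE /= ?tM ?uu0 ?mt ?mx.
have : (#|E| * (m - 2) <= #|plane_class x|)%N.
  have -> : (#|E| * (m - 2) = \sum_(z in E) #|M z.1 :\ z.2 :\ x.1|)%N.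
    rewrite -sum_nat_const; apply: eq_bigr => -[u t]; rewrite !inE /=.
    move=> /and3P[/and3P[_ _ /andP[tM _]] /andP[xM _] xt].
    by rewrite -(Mm u) (cardsD1 t (M u)) (cardsD1 x.1 (M u :\ t)) tM !inE xM xt !subSS subn0.
  rewrite -(card_pair_sum _ (fun z : W * F => M z.1 :\ z.2 :\ x.1)).
  pose h (z : (W * F) * F) := point_at z.1.1 z.2.
  rewrite -(@card_in_imset _ _ h).
    apply/subset_leq_card/subsetP => _ /imsetP[[[u t] s] + ->].
    rewrite !inE /= => /andP[/and3P[/and3P[tM uu0 mt] mx xt] /and3P[sx st sM]].
    have ms : marked u (point_at u s) by rewrite marked_point.
    rewrite MS //= (heightE ms mt) (heightE mx mt) scaler_eq0 !subr_eq0 negb_or st uu0 /=.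
    apply/existsP; exists ((s - t) / (x.1 - t)); rewrite scalerA divfK //.
    by rewrite subr_eq0.
  move=> [[u t] s] [[u' t'] s']; rewrite !inE /=.
  move=> /andP[/and3P[/and3P[tM uu0 mt] mx xt] /and3P[sx st sM]].
  move=> /andP[/and3P[/and3P[tM' uu0' mt'] mx' xt'] /and3P[sx' st' sM']] [es ep]; subst s'.
  have ms : marked u (point_at u s) by rewrite marked_point.
  have ms' : marked u' (point_at u s) by rewrite /marked /= sM' ep eqxx.
  have eu := line_unique ms ms' mx mx' sx; subst u'.
  have [-> //|tt] := eqVneq t t'.
  have m0t : marked u0 (point_at u0 t) by rewrite marked_point.
  have m0t' : marked u0 (point_at u0 t') by rewrite marked_point.
  by case/eqP: uu0; apply: (line_unique mt m0t mt' m0t').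
move: hx NE Fm m4; clear; move: #|F| #|plane_class x| #|nbhd x| #|E| => p c n e h1 h2 h3 h4 h5.
have h6 : (m <= 2 * (m - 2))%N by lia.
have := leq_mul h1 h6; have := leq_mul (leqnn (16 * K)) (leq_mul h2 (leqnn (m - 2))).
have := leq_mul (leqnn (16 * K)) h5.
move: (m - 2)%N h3; lia.
Qed.

(** By [bush] there are at most [16 K |S| / |F|] planes through the line [u0] that
    contain a rich point, and they are disjoint off that line. *)
Lemma exists_rich_class : exists2 x, x \in rich_points &
  (#|F| <= 128 * K ^ 2 * #|[set y in rich_points | plane_class y == plane_class x]|)%N.
Proof.
have rS : rich_points \subset S by apply/subsetP => x; rewrite inE => /andP[].
have r0 : rich_points != set0.
  rewrite -card_gt0; case: #|rich_points| card_rich_points => //; rewrite muln0.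
  rewrite leqn0 cards_eq0 => /eqP S0; have := MS (u := 0); have := Mm 0.
  case: (set_0Vmem (M 0)) => [-> |[t tM] _ /(_ t tM)]; last by rewrite S0 inE.
  by rewrite cards0 => m0; move: m4; rewrite -m0.
have [x0 x0r] := set0Pn _ r0.
pose J := plane_class @: rich_points.
have JS : (\sum_(j in J) #|j| <= #|S|)%N.
  have /eqP -> : trivIset J.
    apply/trivIsetP => _ _ /imsetP[x _ ->] /imsetP[y _ ->]; apply: contraR.
    rewrite -setI_eq0 => /set0Pn[z /setIP[zx zy]].
    by rewrite -(plane_class_eq zx) -(plane_class_eq zy).
  apply/subset_leq_card/bigcupsP => _ /imsetP[x _ ->].
  by apply/subsetP => y; rewrite inE => /andP[].
pose T j := [set y in rich_points | plane_class y == j].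
have Tr : (#|rich_points| = \sum_(j in J) #|T j|)%N.
  rewrite -sum1_card (partition_big_imset plane_class) /=; apply: eq_bigr => j _.
  by rewrite -sum1dep_card; apply: eq_bigl => i.
have [j jJ hj] : exists2 j, j \in J & (#|j| * #|rich_points| <= #|S| * #|T j|)%N.
  apply: (@exists_average _ J _ _ (plane_class x0)); first exact: imset_f.
  by rewrite -big_distrl -[leqRHS](big_distrr #|S|) /= -Tr leq_mul2r JS orbT.
case/imsetP: jJ hj => x xr -> hj; exists x => //.
rewrite -card_gt0 in r0; have hb := bush xr.
have h : (#|plane_class x| <= 8 * K * #|T (plane_class x)|)%N.
  rewrite -(leq_pmul2r r0); apply: leq_trans hj _.
  by have := leq_mul card_rich_points (leqnn #|T (plane_class x)|); clear; lia.
by have := leq_mul (leqnn (16 * K)) h; move: hb; rewrite -/(T _); clear; lia.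
Qed.

(** Reduction to a plane through the line [u0] that contains many rich points.
    Distinct lines having distinct directions, at most |F| of them lie in that
    plane and cross [u0]; hence few of the points of [u0] lie on more than about
    the square root of |F| of these lines, and they can be discarded. *)
Lemma field_card_bound : (forall x : F, exists n, x = n%:R) -> (m ^ 2 <= 4 * #|F|)%N ->
  (#|F| <= ((K ^ 9) ^ 209) ^ ((20 * (487 * 9) + 15) * 2))%N.
Proof.
move=> primeF mF; have [x0 x0r hx0] := exists_rich_class.
have w0 := rich_points_height x0r; set w := height x0 in w0.
have m0 : (0 < m)%N by apply: leq_trans m4.
have k2 i : (2 ^ i <= K ^ i)%N by case: i => // i; rewrite leq_exp2r.
have hK i j : (i <= j)%N -> (K ^ i <= K ^ j)%N by move=> ij; rewrite leq_exp2l.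
have K0 : (0 < K)%N by apply: ltnW.
(* homogeneous coordinates sending [u0] to infinity: the point of abscissa
   [s] and height [r w] is given by [(s / r, 1 / r)] *)
pose pos (z : F * F) : F * W := (z.1 / z.2, b u0 + (z.1 / z.2) *: u0 + z.2^-1 *: w).
pose P := [set z | (z.2 != 0) && (pos z \in rich_points)].
(* for fixed [t] the lines through the point [t] of [u0] become the level sets
   of [z.1 - t * z.2]; the line at level [r] is [u0 + r^-1 w] *)
pose V t := [set r | (r != 0) && marked (u0 + r^-1 *: w) (point_at u0 t)].
have sV : (\sum_(t in M u0) #|V t| <= #|F|)%N.
  rewrite -(card_pair_sum _ V) -(@card_in_imset _ _ snd).
    by rewrite -cardsT; apply/subset_leq_card/subsetT.
  move=> [t r] [t' r']; rewrite !inE /= => /and3P[tM r0 mr] /and3P[tM' _ mr'] e; subst r'.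
  have [-> //|tt] := eqVneq t t'.
  have m0t : marked u0 (point_at u0 t) by rewrite marked_point.
  have m0t' : marked u0 (point_at u0 t') by rewrite marked_point.
  have /eqP := line_unique mr m0t mr' m0t' tt.
  by rewrite addrC -subr_eq0 addrK scaler_eq0 invr_eq0 (negPf r0) (negPf w0).
pose D := (16 * K * m)%N.
pose good := [set t in M u0 | #|V t| <= D]%N.
pose bad := [set t in M u0 | D < #|V t|]%N.
have cbad : (16 * K * #|bad| <= m)%N.
  rewrite -(leq_pmul2r m0); apply: (@leq_trans #|F|); last by rewrite mulnn.
  apply: leq_trans sV; rewrite (big_setID bad) /=; apply: leq_trans (leq_addr _ _).
  rewrite (setIidPr _); last by apply/subsetP => t; rewrite inE => /andP[].
  rewrite mulnAC mulnC -/D -sum_nat_const; apply: leq_sum => t; rewrite inE => /andP[_].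
  exact: ltnW.
apply: (@plane_bound F good V P m (K ^ 9)) => //.
- by rewrite (leq_trans K1) // -[X in (X <= _)%N]expn1 hK.
- by rewrite -(Mm u0); apply/subset_leq_card/subsetP => t; rewrite inE => /andP[].
- move=> t; rewrite inE => /andP[_ h]; apply: leq_trans h _; rewrite leq_mul2r.
  apply/orP; right; apply: (@leq_trans (K ^ 5)); last exact: hK.
  by rewrite expnSr leq_mul2r (k2 4%N) orbT.
- apply: leq_trans hx0 _; apply: leq_mul.
    by rewrite (expnD K 7 2) leq_mul2r (k2 7%N) orbT.
  apply: leq_trans (leq_imset_card pos P); apply/subset_leq_card/subsetP => x.
  rewrite inE => /andP[xr /eqP ex]; have hx := rich_points_height xr.
  have : x \in plane_class x.
    rewrite inE hx; move: xr; rewrite inE => /andP[-> _] /=.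
    by apply/existsP; exists 1; rewrite scale1r.
  rewrite ex inE => /and3P[_ _ /existsP[r /eqP er]].
  have r0 : r != 0 by apply: contraNneq hx => r0; rewrite er r0 scale0r.
  have pE : x = pos (x.1 / r, r^-1).
    rewrite /pos /= invrK divfK // -er /height addrC subrK.
    exact: surjective_pairing.
  by rewrite {1}pE imset_f // inE /= invr_eq0 r0 -pE.
move=> z; rewrite inE => /andP[z0 zr].
set N := [set t in good | _].
have : nbhd (pos z) \subset N :|: bad.
  apply/subsetP => t; rewrite inE => /andP[tM /existsP[u /and4P[uu0 mx mt xt]]].
  rewrite !inE tM /= [(D < _)%N]ltnNge; case: (_ <= D)%N => //=; rewrite orbF.
  have hw : w = (z.1 - t * z.2) *: (u - u0).
    have e : height (pos z) = z.2^-1 *: w by rewrite /height /= addrC addKr.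
    have z0' : z.2^-1 != 0 by rewrite invr_eq0.
    apply: (scalerI z0'); rewrite -e (heightE mx mt) scalerA; congr (_ *: _).
    by rewrite /=; field.
  have r0 : z.1 - t * z.2 != 0 by apply: contraNneq w0 => r0; rewrite hw r0 scale0r.
  by rewrite r0 /= hw scalerA mulVf // scale1r addrC subrK.
move=> /subset_leq_card /leq_trans/(_ (leq_card_setU _ _).1).
move: zr; rewrite inE => /andP[_]; move: cbad.
have := leq_mul (k2 4%N) (leqnn (K ^ 5 * #|N|)); rewrite [X in (_ <= X)%N]mulnA -expnD.
have := leq_mul (leqnn (2 ^ 4)) (leq_mul (hK 1%N 5%N isT) (leqnn #|N|)).
move: #|N| #|bad| #|nbhd _| (K ^ 9)%N (K ^ 5)%N; clear => a c e k9 k5 h1 h2 h3 h4 h5.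
have := leq_mul (leqnn K) h5; lia.
Qed.
End BaseLine.
End Lines.

(** * The lower bound *)

Local Open Scope ring_scope.

Lemma exists_subset_card (T : finType) (A : {set T}) (m : nat) :
  (m <= #|A|)%N -> exists2 B : {set T}, B \subset A & #|B| = m.
Proof.
move=> mA; exists [set x in take m (enum A)].
  by apply/subsetP => x; rewrite inE => /mem_take; rewrite mem_enum.
by rewrite cardsE (card_uniqP (take_uniq _ (enum_uniq _))) size_takel // -cardE.
Qed.

(** The combinatorial form of the theorem, with an exponent that does not depend on
    the dimension. *)
Lemma furstenberg_bound : exists E : nat, (0 < E)%N /\
  forall (p k K : nat) (S : {set 'rV['F_p]_(1 + k)}), prime p -> (0 < k)%N -> (1 < K)%N ->
  (forall v : 'rV['F_p]_(1 + k), v != 0 ->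
     exists a, (p <= #|line a v :&: S| ^ 2)%N) ->
  (#|S| ^ 2 <= K * p ^ k.+1)%N -> (p <= K ^ E)%N.
Proof.
(* the exponent is kept abstract: its unary representation is too large *)
have [e eE] : exists e, e = ((20 * (487 * 9) + 15) * 2)%N by eexists.
have e0 : (0 < e)%N by rewrite eE muln_gt0 addn_gt0 orbT.
exists (9 * 209 * e)%N.
split=> [|p k K S pp k0 K1 hS SK]; first by rewrite muln_gt0.
have cF : #|'F_p| = p by exact: card_Fp.
have k2 i : (2 ^ i <= K ^ i)%N by case: i => // i; rewrite leq_exp2r.
have small : (p <= K ^ 4)%N -> (p <= K ^ (9 * 209 * e))%N.
  move=> /leq_trans; apply; rewrite leq_exp2l // -mulnA.
  by apply: (@leq_trans 9) => //; rewrite leq_pmulr // muln_gt0.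
have [pK|pK] := ltnP p (4 * K).
  apply: small; apply: leq_trans (ltnW pK) _; apply: (@leq_trans (K ^ 3)); last first.
    by rewrite leq_exp2l.
  by rewrite expnSr leq_mul2r (k2 2%N) orbT.
pose phi (x : 'rV['F_p]_(1 + k)) : 'F_p * 'rV['F_p]_k := (lsubmx x 0 0, rsubmx x).
have phi_inj : injective phi.
  move=> x y [e1 e2]; rewrite -(hsubmxK x) -(hsubmxK y) e2; congr row_mx.
  by apply/rowP => i; rewrite ord1.
pose dir (u : 'rV['F_p]_k) : 'rV['F_p]_(1 + k) := row_mx (const_mx 1) u.
have dir0 u : dir u != 0.
  apply/eqP => /(congr1 (fun x => lsubmx x 0 0)); rewrite /dir row_mxKl !mxE => /eqP.
  by rewrite oner_eq0.
(* [m] is the square root of [p], rounded up *)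
pose P (m : nat) := (p <= m ^ 2)%N.
have Pp : P p by rewrite /P -mulnn leq_pmull // prime_gt0.
have exP : exists m, P m by exists p.
case: (ex_minnP exP) => m Pm mmin.
have m0 : (0 < m)%N by case: (m) Pm => //; rewrite /P exp0n // leqNgt prime_gt0.
have m4p : (m ^ 2 <= 4 * p)%N.
  have [m1|m1] := leqP m 1.
    have := leq_mul m1 m1; have := prime_gt0 pp; rewrite -mulnn; lia.
  have : ~~ P m.-1 by apply/negP => /mmin; lia.
  rewrite /P -ltnNge => h; apply: leq_trans (leq_mul (leqnn 4) (ltnW h)).
  by rewrite -(expnMn 2 _ 2) leq_exp2r //; lia.
have [m4|m4] := ltnP m 4.
  apply: small; apply: leq_trans Pm _; apply: leq_trans (k2 4%N).
  by rewrite (expnM 2 2 2) leq_exp2r // ltnW.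
(* only the directions [(1, u)] are used; the line is parametrized by its first
   coordinate *)
have hM (u : 'rV['F_p]_k) : exists bM : 'rV['F_p]_k * {set 'F_p},
    #|bM.2| = m /\ forall t, t \in bM.2 -> (t, bM.1 + t *: u) \in phi @: S.
  have [a ha] := hS _ (dir0 u).
  pose b := rsubmx a - lsubmx a 0 0 *: u.
  pose A := [set t | (t, b + t *: u) \in phi @: S].
  have : (m <= #|A|)%N.
    apply: mmin; apply: leq_trans ha _; rewrite leq_exp2r //.
    have inj : {in line a (dir u) :&: S &, injective (fun x => lsubmx x 0 0)}.
      move=> x y /setIP[/imsetP[s _ ->] _] /setIP[/imsetP[t _ ->] _].
      by rewrite !linearD !linearZ /= /dir row_mxKl !mxE !mulr1 => /addrI ->.
    rewrite -(card_in_imset inj); apply/subset_leq_card/subsetP => _ /imsetP[x /setIP[xl xS] ->].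
    rewrite inE; apply/imsetP; exists x => //; rewrite /phi; congr (_, _).
    case/imsetP: xl => s _ ->; rewrite !linearD !linearZ /= /dir row_mxKl row_mxKr /b.
    by apply/rowP => i; rewrite !mxE; ring.
  move=> /exists_subset_card[B /subsetP BA cB]; exists (b, B); split => // t /BA.
  by rewrite inE.
have [f hf] := fin_all_exists hM.
have cS : #|phi @: S| = #|S| by exact: card_imset.
have FK : (#|phi @: S| ^ 2 <= K * (#|'F_p| * #|{: 'rV['F_p]_k}|))%N.
  by rewrite cS card_mx mul1n cF -expnS.
have FW : (#|'F_p| <= #|{: 'rV['F_p]_k}|)%N.
  by rewrite card_mx mul1n cF -[X in (X <= _)%N]expn1 leq_pexp2l // prime_gt0.
have primeF (x : 'F_p) : exists n, x = n%:R by exists (x : nat); rewrite natr_Zp.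
have Mm u : #|(f u).2| = m by case: (hf u).
have MS u t : t \in (f u).2 -> point_at (fun u => (f u).1) u t \in phi @: S.
  by case: (hf u) => _; apply.
rewrite -cF in m4p; rewrite -cF in pK; rewrite /P -cF in Pm.
have [u0 hu0] := exists_crossed_line K1 Mm MS Pm m4 FW FK pK.
have := field_card_bound K1 Mm MS Pm m4 hu0 primeF m4p.
by rewrite cF -eE -!expnM mulnA.
Qed.

Theorem theorem1p4 (R : realType) :
  exists c : R, 0 < c /\
  forall n : nat, (2 <= n)%N ->
  exists C : R, 0 < C /\
  forall (p : nat) (S : {set 'rV['F_p]_n}),
    prime p ->
    (forall v : 'rV['F_p]_n, v != 0 ->
       exists l : {set 'rV['F_p]_n},
         line_in_direction v l /\ p%:R `^ (1 / 2) <= #|l :&: S|%:R :> R) ->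
    C * p%:R `^ (n%:R / 2 + c / n%:R ^+ 2) <= #|S|%:R.
Proof.
have [E [E0 hE]] := furstenberg_bound.
pose c : R := (2 * E%:R)^-1.
have c0 : 0 < c by rewrite invr_gt0 mulr_gt0 // ltr0n.
exists c; split => // -[//|k] k1.
set a := k.+1%:R / 2 + c / k.+1%:R ^+ 2.
have a0 : 0 <= a by rewrite addr_ge0 // divr_ge0 // ?exprn_ge0 // ltW.
(* the primes below [2 ^ E] are dealt with by this factor in the constant *)
pose B : R := (2 ^ E)%N%:R `^ a.
have B1 : 1 <= B.
  have <- : 1 `^ a = 1 :> R by rewrite powR1.
  by apply: ge0_ler_powR; rewrite ?nnegrE // ler1n expn_gt0.
have B0 : 0 < B by apply: lt_le_trans B1.
exists (2 * B)^-1; split; first by rewrite invr_gt0 mulr_gt0.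
move=> p S pp hS.
have p0 : (0 < p)%N by exact: prime_gt0.
have hS' (v : 'rV['F_p]_(1 + k)) : v != 0 ->
     exists x, (p <= #|line x v :&: S| ^ 2)%N.
  move=> /hS[l [[_ [x ->]] h]]; exists x => //.
  rewrite -(ler_nat R) natrX; apply: le_trans (_ : (p%:R `^ (1 / 2)) ^+ 2 <= _).
    by rewrite -powR_mulrn ?powR_ge0 // -powRrM mul1r mulVf ?pnatr_eq0 // powRr1.
  by rewrite lerXn2r ?nnegrE ?powR_ge0.
have S0 : (0 < #|S|)%N.
  pose v : 'rV['F_p]_k.+1 := const_mx 1.
  have : v != 0.
    apply/eqP => /(congr1 (fun x : 'rV['F_p]_k.+1 => x 0 0)); rewrite !mxE => /eqP.
    by rewrite oner_eq0.
  move=> /hS'[x h]; have : (#|line x v :&: S| <= #|S|)%N by exact/subset_leq_card/subsetIr.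
  by apply: leq_trans; case: #|_| h => //; rewrite exp0n // leqNgt p0.
have Sr : 1 <= #|S|%:R :> R by rewrite ler1n.
rewrite invfM mulrAC.
have [p2E|p2E] := leqP p (2 ^ E).
  rewrite ler_pdivrMr // mulrC; apply: le_trans (_ : B <= _).
    apply: le_trans (_ : p%:R `^ a <= _).
      by rewrite ler_piMr ?powR_ge0 // invf_le1 // ler1n.
    by apply: ge0_ler_powR; rewrite ?nnegrE // ler_nat.
  by rewrite ler_peMl // ltW.
(* [K] is the least integer above |S|^2 / p^n; as [p] is large it is at least 3,
   so that rounding costs a constant factor only *)
pose K := (#|S| ^ 2 %/ p ^ k.+1).+1.
have pk0 : (0 < p ^ k.+1)%N by rewrite expn_gt0 p0.
have SK : (#|S| ^ 2 <= K * p ^ k.+1)%N by rewrite ltnW // ltn_ceil.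
have K3 : (2 < K)%N.
  rewrite ltnNge; apply/negP => K2; move: p2E; rewrite ltnNge => /negP; apply.
  apply: (hE p k 2 S) => //; apply: leq_trans SK _.
  by rewrite leq_mul2r K2 orbT.
have pKE := hE p k K S pp k1 (ltnW K3) hS' SK.
have KS : (K * p ^ k.+1 <= 4 * #|S| ^ 2)%N.
  apply: (@leq_trans (4 * (#|S| ^ 2 %/ p ^ k.+1 * p ^ k.+1))); last first.
    by rewrite leq_mul2l leq_trunc_div.
  by rewrite mulnA leq_mul2r; apply/orP; right; move: K3; rewrite /K; lia.
apply: le_trans (_ : 2^-1 * p%:R `^ a <= _).
  by rewrite ler_pdivrMr // ler_peMr // mulr_ge0 ?powR_ge0 // invr_ge0.
rewrite mulrC ler_pdivrMr // -(@ler_pXn2r _ 2) ?nnegrE ?powR_ge0 ?mulr_ge0 //.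
have pr1 : 1 <= p%:R :> R by rewrite ler1n.
have aE : a * 2 <= k.+1%:R + E%:R^-1.
  rewrite /a mulrDl divfK ?pnatr_eq0 // lerD2l /c invfM mulrAC [2^-1 * _]mulrC mulfVK ?pnatr_eq0 //.
  by rewrite ler_piMr ?invr_ge0 // invf_le1 ?exprn_gt0 ?ltr0n // -natrX ler1n expn_gt0.
apply: le_trans (_ : p%:R `^ (k.+1%:R + E%:R^-1) <= _).
  by rewrite -powR_mulrn ?powR_ge0 // -powRrM ler_powR.
rewrite powRD; last by rewrite pnatr_eq0 -lt0n p0 implybT.
rewrite powR_mulrn // -natrX mulrC exprMn -!natrX -natrM.
apply: le_trans (_ : K%:R * (p ^ k.+1)%:R <= _).
  apply: ler_pM; rewrite ?powR_ge0 //.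
  have -> : K%:R = (K ^ E)%N%:R `^ E%:R^-1 :> R.
    by rewrite natrX -powR_mulrn // -powRrM mulfV ?pnatr_eq0 -?lt0n // powRr1.
  by apply: ge0_ler_powR; rewrite ?nnegrE ?invr_ge0 // ler_nat.
by rewrite -natrM ler_nat mulnC [(_ * 4)%N]mulnC; rewrite [(p ^ _ * _)%N]mulnC.
Qed.
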